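(* For $p,q\in\mathbb{N}$ with $1\le q<p$ let \[ N(p,q)=\sum_{j\vdash q-1}\ \sum_{k\vdash p-q}\left(\prod_{i=1}^{q-1} j_i!\,i^{j_i}\prod_{i=1}^{p-q}k_i!\,i^{k_i}\right)^{-1}\prod_{a,b=1}^{p-q}\Bigl(1+\sum_{d\mid \operatorname{lcm}(a,b)} d\,j_d\Bigr)^{k_ak_b\gcd(a,b)} \] and \[ L(p,q)=\tfrac12 N(p,q)+\tfrac12\sum_{j\vdash q-1}\ \sum_{k\vdash p-q}\left(\prod_{i=1}^{q-1} j_i!\,i^{j_i}\prod_{i=1}^{p-q}k_i!\,i^{k_i}\right)^{-1}\prod_{a=1}^{p-q}\Bigl(q_a^{k_a}\,p_{a,a}^{k_a^2-k_a}\prod_{b=1}^{a-1}p_{a,b}^{2k_ak_b}\Bigr), \] where, writing $C_t=1+\sum_{d\mid t} d\,j_d$, \[ p_{a,b}=C_{\operatorname{lcm}(2,a,b)}^{\,ab/\operatorname{lcm}(2,a,b)},\qquad q_a=\begin{cases} C_a\,C_{2a}^{(a-1)/2} & a\equiv 1\pmod 2,\\ C_a^{\,a} & a\equiv 0\pmod 4,\\ C_{a/2}^{\,2}\,C_a^{\,a-1} & a\equiv 2\pmod 4.\end{cases} \] Then for every $n\in\mathbb{N}$ the number of nilpotent semigroups of degree $3$ of order $n$ up to isomorphism or anti-isomorphism equals \[ \sum_{m=2}^{a(n)}\bigl(L(n,m)-L(n-1,m-1)\bigr),\qquad a(n)=\left\lfloor n+\tfrac12-\sqrt{n-\tfrac34}\,\right\rfloor.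 \]
   Context: A semigroup $S$ is nilpotent of degree $3$ if $|S^3|=1$ and $|S^2|>1$, where $S^r=\{s_1\cdots s_r : s_i\in S\}$. The dual $S^*$ of $S$ is the set $S$ with multiplication $x\ast y=yx$; a bijection $f:S\to T$ is an anti-isomorphism if it is an isomorphism from $S^*$ to $T$. Two semigroups are identified ''up to isomorphism or anti-isomorphism'' if there is an isomorphism or an anti-isomorphism between them. $j\vdash n$ means $j$ is a partition of $n$ (empty if $n=0$), $j_i$ is the number of parts of $j$ equal to $i$; sums over $d\mid t$ range over positive divisors of $t$. *)

(* Defs.v *)
From HB Require Import structures.
From mathcomp Require Import all_boot all_order all_algebra.
From mathcomp Require Import fingroup perm algC.
Set Implicit Arguments. Unset Strict Implicit. Unset Printing Implicit Defensive.
Import Order.TTheory GRing.Theory Num.Theory.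

(* A semigroup of order n is (up to isomorphism) a multiplication table on 'I_n. *)
Definition table (n : nat) := {ffun 'I_n * 'I_n -> 'I_n}.

Definition assoc n (m : table n) : bool :=
  [forall x, forall y, forall z, m (m (x, y), z) == m (x, m (y, z))].

Definition sq n (m : table n) : {set 'I_n} :=
  [set m (x, y) | x : 'I_n, y : 'I_n].
Definition cube n (m : table n) : {set 'I_n} :=
  [set m (u, z) | u in sq m, z in [set: 'I_n]].

Definition nilp3 n (m : table n) : bool :=
  [&& assoc m, #|cube m| == 1 & 1 < #|sq m|].

Definition iso_or_anti n (m1 m2 : table n) : bool :=
  [exists s : {perm 'I_n}, [forall x, forall y, s (m1 (x, y)) == m2 (s x, s y)]]
  || [exists s : {perm 'I_n}, [forall x, forall y, s (m1 (x, y)) == m2 (s y, s x)]].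

Definition num_nilp3 (n : nat) : nat :=
  #|equivalence_partition (@iso_or_anti n) [set m : table n | nilp3 m]|.

(* A partition j of n is given by its multiplicities j_1, ..., j_n
   (each j_i <= n), with sum_i i * j_i = n. *)
Definition parts (n : nat) : {set {ffun 'I_n -> 'I_n.+1}} :=
  [set j : {ffun 'I_n -> 'I_n.+1} | \sum_(i < n) i.+1 * j i == n].

(* j_i for any i : nat (0 if i = 0 or i > n) *)
Definition mult n (j : {ffun 'I_n -> 'I_n.+1}) (i : nat) : nat :=
  match i with
  | 0 => 0
  | i'.+1 => oapp (fun o : 'I_n => nat_of_ord (j o)) 0 (insub i')
  end.

Definition zc n (j : {ffun 'I_n -> 'I_n.+1}) : nat :=
  \prod_(1 <= i < n.+1) ((mult j i)`! * i ^ (mult j i)).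

Definition Cc n (j : {ffun 'I_n -> 'I_n.+1}) (t : nat) : nat :=
  1 + \sum_(1 <= d < t.+1 | d %| t) d * mult j d.

(* p_{a,b}^e = C_l^{(ab/l) e} with l = lcm(2,a,b); in every use the
   exponent (a b e)/l is an integer *)
Definition ppow n (j : {ffun 'I_n -> 'I_n.+1}) (a b e : nat) : nat :=
  let l := lcmn 2 (lcmn a b) in Cc j l ^ ((a * b * e) %/ l).

Definition qa n (j : {ffun 'I_n -> 'I_n.+1}) (a : nat) : nat :=
  if odd a then Cc j a * Cc j (2 * a) ^ ((a - 1) %/ 2)
  else if 4 %| a then Cc j a ^ a
  else Cc j (a %/ 2) ^ 2 * Cc j a ^ (a - 1).

Local Open Scope ring_scope.

Definition Nf (p q : nat) : rat :=
  \sum_(j in parts (q - 1)) \sum_(k in parts (p - q))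
    ((zc j * zc k)%N%:R)^-1 *
    (\prod_(1 <= a < (p - q).+1) \prod_(1 <= b < (p - q).+1)
        Cc j (lcmn a b) ^ (mult k a * mult k b * gcdn a b))%N%:R.

Definition Lf (p q : nat) : rat :=
  2^-1 * Nf p q +
  2^-1 * \sum_(j in parts (q - 1)) \sum_(k in parts (p - q))
    ((zc j * zc k)%N%:R)^-1 *
    (\prod_(1 <= a < (p - q).+1)
       (qa j a ^ mult k a * ppow j a a (mult k a ^ 2 - mult k a) *
        \prod_(1 <= b < a) ppow j a b (2 * mult k a * mult k b)))%N%:R.

Definition an (n : nat) : int :=
  Num.floor (n%:R + 2^-1 - sqrtC (n%:R - 3%:R / 4%:R) : algC).

(* Main.v *)
(** A nilpotent semigroup of degree 3 on n elements is determined by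
[B = S^2], its zero [z] in [B], and a multiplication [A * A -> B] on the
complement [A] of [B]; all other products are [z].  Conversely every map
[A * A -> B] whose image contains [B \ {z}] occurs, and two of them give
(anti-)isomorphic semigroups exactly when they are conjugate under
[Sym A * Sym (B \ {z}) * Z/2], the last factor swapping the arguments.  With
[|S| = p] and [|B| = q], [L(p, q)] counts the orbits of all maps [A * A -> B] by
Burnside's lemma; the orbits of maps missing some point of [B \ {z}] are the
orbits of maps into a set with one point fewer, hence the difference
[L(n, m) - L(n - 1, m - 1)].  The bound [m <= a(n)] says
[m - 1 <= (n - m)^2], without which no map has the required image.

For Burnside, a map equivariant for [pi] on [X] and [tau] on [Y] amounts to
choosing, for each cycle of [pi] of length [l], a fixed point of [tau^l]; the
cycle lengths of [s * s] and of its composite with the swap are computed from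
those of [s].  Averages over symmetric groups become sums over partitions because
[n! / prod_i (j_i! i^(j_i))] permutations have cycle type [j], by induction
on [n], inserting a new point into a cycle. *)

Require Import Defs.
From HB Require Import structures.
From mathcomp Require Import all_boot all_order all_algebra.
From mathcomp Require Import all_fingroup algC zify ring.
Import Order.TTheory GRing.Theory Num.Theory.
Set Implicit Arguments. Unset Strict Implicit. Unset Printing Implicit Defensive.

Local Notation forder := fingraph.order.

(** * Equivariant maps *)

Lemma iter_order_dvd (T : finType) (f : T -> T) (x : T) t :
  injective f -> (iter t f x == x) = (forder f x %| t).
Proof.
move=> injf; set o := forder f x.
have io k : iter (k * o) f x = x.
  by elim: k => //= k IH; rewrite mulSn iterD IH iter_order.
rewrite {1}(divn_eq t o) addnC iterD io; apply/eqP/idP => [h|].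
  have lt : t %% o < forder f x by rewrite ltn_mod fingraph.order_gt0.
  by have := findex_iter lt; rewrite h findex0 /dvdn => <-.
by rewrite /dvdn => /eqP ->.
Qed.

(** Reads off a cycle length from the exponents whose iterates fix the point; the periods of pairs
    are computed this way. *)
Lemma order_eq_dvd (T : finType) (f : T -> T) (x : T) l :
  injective f -> (forall t, (iter t f x == x) = (l %| t)) -> forder f x = l.
Proof.
move=> injf h; apply/eqP; rewrite eqn_dvd.
by rewrite -iter_order_dvd // h dvdnn /= -h iter_order.
Qed.

Lemma order_fconnect (T : finType) (f : T -> T) (x y : T) :
  injective f -> fconnect f x y -> forder f y = forder f x.
Proof.
move=> injf /iter_findex <-; elim: (findex _ _ _) => //= m <-.
by apply: fingraph.order_id_cycle; apply: cycle_orbit.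
Qed.

Lemma expn_prod (I : Type) (q : seq I) (P : pred I) (F : I -> nat) N :
  (\prod_(i <- q | P i) F i) ^ N = \prod_(i <- q | P i) F i ^ N.
Proof.
rewrite (big_morph (expn^~ N) (id1 := 1) (op1 := muln)) ?exp1n // => m n.
exact: expnMn.
Qed.

Section Equivariant.
Variables (X Y : finType) (p : X -> X) (t : Y -> Y).
Hypotheses (injp : injective p).

Definition nfix k := #|[pred y | iter k t y == y]|.

Definition equivariant_fns := [set f : {ffun X -> Y} | [forall x, f (p x) == t (f x)]].

Lemma equiv_iter (f : {ffun X -> Y}) k x :
  f \in equivariant_fns -> f (iter k p x) = iter k t (f x).
Proof. by rewrite inE => /forallP h; elim: k => //= k <-; apply/eqP. Qed.

(* An equivariant map is determined by its values at the roots of the p-orbits,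
   and the value at x can be any y fixed by the (forder p x)-th iterate of t. *)
Lemma card_equiv_roots (y0 : Y) :
  #|equivariant_fns| = \prod_(x | froots p x) nfix (forder p x).
Proof.
pose F x := [pred y | iter (forder p x) t y == y].
(* [y0] fills the values off the roots, so that [rst f] has the shape required by [pfamily]. *)
pose rst (f : {ffun X -> Y}) := [ffun x => if froots p x then f x else y0].
have connC x : fconnect p (froot p x) x.
  by rewrite (fconnect_sym injp) connect_root.
have -> : \prod_(x | froots p x) nfix (forder p x) = #|pfamily y0 (froots p) F|.
  by rewrite card_pfamily foldrE big_map big_enum_cond /=; apply: eq_bigl => x; rewrite andbT.
have inj : {in equivariant_fns &, injective rst}.
  move=> f g hf hg /ffunP e; apply/ffunP => x.
  rewrite -(iter_findex (connC x)) !equiv_iter //.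
  by have := e (froot p x); rewrite !ffunE (roots_root (fconnect_sym injp)) => ->.
rewrite -(card_in_imset inj); apply: eq_card => h; apply/imsetP/pfamilyP.
  case=> f hf ->; split.
    by apply/supportP => x nx; rewrite ffunE; case: ifP => // rx; case/negP: nx.
  move=> x rx; have {}rx : froots p x by [].
  by rewrite ffunE rx inE -equiv_iter // iter_order.
case=> /supportP h0 hF.
(* The preimage under [rst]: the value chosen at a root is carried along its cycle by [t]. *)
pose f := [ffun x => iter (findex p (froot p x) x) t (h (froot p x))].
have rootp x : froot p (p x) = froot p x.
  by apply/(fingraph.rootP (fconnect_sym injp)); rewrite (fconnect_sym injp) fconnect1.
(* Needed where a cycle closes: [findex] then drops to 0 instead of growing by one, which is
   harmless because [t] iterated once around the cycle fixes [h r]. *)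
have hper r k m : froots p r -> k = m %[mod forder p r] -> iter k t (h r) = iter m t (h r).
  move=> rr; have /eqP io : iter (forder p r) t (h r) == h r by apply: hF.
  have iom j : iter (j * forder p r) t (h r) = h r.
    by elim: j => //= j IH; rewrite mulSn iterD IH.
  move=> e; rewrite (divn_eq k (forder p r)) (divn_eq m (forder p r)) ![_ * _ + _]addnC !iterD.
  by rewrite !iom e.
exists f.
  rewrite inE; apply/forallP => x; rewrite !ffunE rootp -iterS; apply/eqP.
  apply: hper; first by rewrite (roots_root (fconnect_sym injp)).
  set r := froot p x; set i := findex p r x.
  have ix : iter i p r = x by apply: iter_findex; apply: connC.
  have hr : fconnect p r (p x) by rewrite /r -(rootp x).
  have ipx : iter (findex p r (p x)) p r = iter i.+1 p r.
    by rewrite iter_findex //= ix.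
  have lf : findex p r (p x) < forder p r := findex_max hr.
  have io k : iter (k * forder p r) p r = r.
    by elim: k => //= k IH; rewrite mulSn iterD IH iter_order.
  move: ipx; rewrite (divn_eq i.+1 (forder p r)) addnC iterD io.
  rewrite -/(forder p r) => e.
  have lm : i.+1 %% forder p r < forder p r by rewrite ltn_mod fingraph.order_gt0.
  by rewrite -(findex_iter lm) -e (findex_iter lf) addnC modnMDl.
apply/ffunP => x; rewrite ffunE; case: ifP => [rx|nrx]; last first.
  by rewrite h0 // unfold_in; apply/negP; rewrite /= -/(froots p x) nrx.
have /eqP e : froot p x == x by [].
by rewrite ffunE e findex0.
Qed.

(* Raising to a common multiple M of the cycle lengths turns the product over
   cycles into a product over points. *)
Lemma card_equiv_exp (y0 : Y) M : (forall x, forder p x %| M) ->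
  #|equivariant_fns| ^ M = \prod_x nfix (forder p x) ^ (M %/ forder p x).
Proof.
move=> hM; rewrite (card_equiv_roots y0) expn_prod.
rewrite [RHS](partition_big (froot p) (froots p)) /=; last first.
  by move=> x _; rewrite (roots_root (fconnect_sym injp)).
apply: eq_bigr => r rr.
have conn x : (froot p x == r) = fconnect p r x.
  by rewrite -(root_connect (fconnect_sym injp)) (eqP (rr : froot p r == r)) eq_sym.
rewrite (eq_bigr (fun=> nfix (forder p r) ^ (M %/ forder p r))) => [|x]; last first.
  by rewrite conn => /(order_fconnect injp) ->.
(* The cycle has [forder p r] points, each with exponent [M %/ forder p r]; together they give
   [M]. *)
rewrite prod_nat_const (eq_card conn) -/(forder p r) -expnM divnK //.
Qed.
End Equivariant.

(** * Counting permutations by cycle type *)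

Lemma sum_bool_card (T : finType) (P : pred T) : \sum_x (P x : nat) = #|P|.
Proof.
rewrite -sum1_card [RHS]big_mkcond; apply: eq_bigr => x _.
by rewrite unfold_in; case: (P x).
Qed.

Definition cyc (T : finType) (f : T -> T) i := #|order_set f i| %/ i.

(** The points of period [i] fall into cycles of [i] points each, so the division in [cyc] is
    exact. *)
Lemma cycM (T : finType) (f : T -> T) i :
  injective f -> cyc f i * i = #|order_set f i|.
Proof.
move=> injf; rewrite /cyc.
suff <- : fcard f (order_set f i) * i = #|order_set f i|.
  by case: i => [|i]; rewrite ?muln0 // mulnK.
apply: fcard_order_set => // x y /eqP <-; rewrite !inE.
by rewrite fingraph.order_id_cycle //; apply: cycle_orbit.
Qed.

(* [insert_perm s j] inserts the new point [ord0] just before the point [j] in its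
   cycle, or makes it a fixed point if [j = ord0]. *)
Definition insert_perm n (s : {perm 'I_n}) (j : 'I_n.+1) : {perm 'I_n.+1} :=
  (lift_perm ord0 ord0 s * tperm ord0 j)%g.

Lemma insert_perm0 n (s : {perm 'I_n}) j : insert_perm s j ord0 = j.
Proof. by rewrite permM lift_perm_id tpermL. Qed.

Lemma insert_perm_lift n (s : {perm 'I_n}) j k : lift ord0 (s k) != j ->
  insert_perm s j (lift ord0 k) = lift ord0 (s k).
Proof. by move=> h; rewrite permM lift_perm_lift tpermD // eq_sym. Qed.

Lemma insert_perm_liftE n (s : {perm 'I_n}) k :
  insert_perm s (lift ord0 (s k)) (lift ord0 k) = ord0.
Proof. by rewrite permM lift_perm_lift tpermR. Qed.

(** [j] is the image of the new point, and cancelling the transposition then recovers [s]; both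
    sides have [(n + 1)!] elements. *)
Lemma insert_perm_bij n :
  bijective (fun u : {perm 'I_n} * 'I_n.+1 => insert_perm u.1 u.2).
Proof.
apply: inj_card_bij; last by rewrite card_prod !card_Sn card_ord factS mulnC.
move=> [s j] [s' j'] /= e.
have ej : j = j' by rewrite -(insert_perm0 s j) e insert_perm0.
rewrite -ej; congr (_, _); apply/permP => k.
have /(congr1 (fun u : {perm 'I_n.+1} => u (lift ord0 k))) := e.
by rewrite -ej !permM !lift_perm_lift => /perm_inj /lift_inj.
Qed.

(** Insertion redirects only the arrow entering [j], so a cycle of old points without that arrow
    survives. *)
Lemma order_insert_other n (s : {perm 'I_n}) j k :
  (forall y, fconnect s k y -> lift ord0 (s y) != j) ->
  forder (insert_perm s j) (lift ord0 k) = forder s k.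
Proof.
move=> h; rewrite -(size_orbit s k) -(size_map (lift ord0)).
apply: order_cycle.
- apply: (homo_cycle_in (P := mem (fingraph.orbit s k)) (e := frel s)).
  + move=> a b; rewrite -!fconnect_orbit => ka _ /eqP <- /=.
    by rewrite insert_perm_lift //; apply: h.
  + exact/allP.
  + exact: cycle_orbit (@perm_inj _ s) k.
- rewrite map_inj_uniq; [exact: orbit_uniq | exact: lift_inj].
- by apply: map_f; apply: in_orbit.
Qed.

(** Listed from [s k] on, the cycle of [k] ends in [k]. The new arrows go from [k] to [ord0] and
    from [ord0] to [s k], so putting [ord0] in front of the list gives a cycle again. *)
Lemma order_insert_cycle n (s : {perm 'I_n}) k z :
  let c := ord0 :: [seq lift ord0 y | y <- fingraph.orbit s (s k)] in
  z \in c -> forder (insert_perm s (lift ord0 (s k))) z = (forder s k).+1.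
Proof.
move=> c zc; have ok : forder s (s k) = forder s k.
  by apply: fingraph.order_id_cycle; apply: cycle_orbit; apply: perm_inj.
have -> : (forder s k).+1 = size c by rewrite /= size_map size_orbit ok.
have uc : uniq c.
  rewrite /= map_inj_uniq ?orbit_uniq ?andbT; last exact: lift_inj.
  by apply/mapP => -[y _] /eqP; rewrite (negPf (neq_lift _ _)).
apply: order_cycle => //; move: uc; rewrite /c /= {zc}.
rewrite /fingraph.orbit; case E : (forder s (s k)) => [|o].
  by move: (fingraph.order_gt0 s (s k)); rewrite E.
rewrite trajectS /= => /and3P[_ ny _].
rewrite insert_perm0 eqxx rcons_path /=; apply/andP; split.
  apply/(pathP ord0) => i; rewrite size_map size_traject => lio.
  have l1 : i < o.+1 by rewrite ltnS ltnW.
  rewrite -map_cons -trajectS.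
  rewrite (nth_map (s k)) ?size_traject // (nth_map (s k)) ?size_traject //.
  rewrite (nth_traject _ l1) (set_nth_default (s (s k))) ?size_traject // (nth_traject _ lio).
  rewrite -[iter i s (s (s k))]iterSr /= insert_perm_lift //.
  apply: contraNneq ny => <-.
  by apply: map_f; rewrite -iterS iterSr; apply/trajectP; exists i.
(* The closing arrow: the last listed point is [k], which is now sent to the new point. *)
rewrite last_map last_traject -[X in lift ord0 (s X)](f_finv (@perm_inj _ s)).
have -> : iter o s (s k) = k.
  by apply: (@perm_inj _ s); rewrite -iterS -E iter_order //; apply: perm_inj.
by rewrite f_finv ?insert_perm_liftE //; apply: perm_inj.
Qed.

Lemma order_insert0 n (s : {perm 'I_n}) : forder (insert_perm s ord0) ord0 = 1.
Proof.
by apply: (@order_cycle _ _ [:: ord0]) => //=; rewrite insert_perm0 eqxx.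
Qed.

Lemma order_insert0_lift n (s : {perm 'I_n}) k :
  forder (insert_perm s ord0) (lift ord0 k) = forder s k.
Proof. by apply: order_insert_other => y _; rewrite eq_sym neq_lift. Qed.

Lemma order_insert_new n (s : {perm 'I_n}) x :
  forder (insert_perm s (lift ord0 (s x))) ord0 = (forder s x).+1.
Proof. by apply: order_insert_cycle; rewrite inE eqxx. Qed.

Lemma order_insert_lift n (s : {perm 'I_n}) x k :
  forder (insert_perm s (lift ord0 (s x))) (lift ord0 k)
    = forder s k + fconnect s x k.
Proof.
have sI := @perm_inj _ s; case: (boolP (fconnect s x k)) => xk.
  rewrite order_insert_cycle ?addn1.
    by rewrite (order_fconnect sI xk).
  rewrite inE map_f ?orbT // -fconnect_orbit.
  by rewrite -(same_fconnect1 sI).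
rewrite addn0; apply: order_insert_other => y ky; apply: contraNneq xk.
by move=> /lift_inj /sI e; rewrite (fconnect_sym sI) -e.
Qed.

Lemma cyc_insert0 n (s : {perm 'I_n}) i : 0 < i ->
  cyc (insert_perm s ord0) i = cyc s i + (i == 1).
Proof.
move=> i0; have sI := @perm_inj _ s.
apply/eqP; rewrite -(eqn_pmul2r i0) mulnDl !cycM //; last exact: perm_inj.
apply/eqP; rewrite -!sum_bool_card big_ord_recl addnC /order_set /= order_insert0.
congr (_ + _); last by rewrite eq_sym; case: eqP => [->|].
by apply: eq_bigr => k _; rewrite /= order_insert0_lift.
Qed.

(** One cycle is replaced by a cycle one longer. The lost cycle is added on the left to avoid
    truncated subtraction. *)
Lemma cyc_insert n (s : {perm 'I_n}) x i : 0 < i ->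
  cyc (insert_perm s (lift ord0 (s x))) i + (i == forder s x)
    = cyc s i + (i == (forder s x).+1).
Proof.
move=> i0; have sI := @perm_inj _ s.
apply/eqP; rewrite -(eqn_pmul2r i0) !mulnDl !cycM //; last exact: perm_inj.
apply/eqP; rewrite -!sum_bool_card big_ord_recl /order_set /= order_insert_new.
set o := forder s x.
(* Old points only: the [o] points on the cycle of [x] pass from period [o] to period [o.+1]. The
   new point is accounted for afterwards. *)
have e1 : \sum_(k < n) ((forder (insert_perm s (lift ord0 (s x))) (lift ord0 k) == i) : nat)
   + (i == o) * i = \sum_(k < n) ((forder s k == i) : nat) + (i == o.+1) * o.
  have e2 b : (i == b) * o = \sum_(k < n) (fconnect s x k && (i == b)).
    rewrite /o /forder -sum_bool_card big_distrr /=.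
    by apply: eq_bigr => k _; rewrite mulnb andbC.
  have -> : (i == o) * i = (i == o) * o by case: eqP => // ->.
  rewrite !e2 -!big_split; apply: eq_bigr => k _ /=.
  rewrite order_insert_lift; case: (boolP (fconnect s x k)) => xk /=; last by rewrite !addn0.
  by rewrite (order_fconnect sI xk) addn1 addnC ![_ == i]eq_sym.
rewrite -addnA e1 addnCA [o.+1 == i]eq_sym; congr (_ + _).
by case: eqP => [->|] //=; lia.
Qed.

Section CountByType.
Variable N : nat.
Implicit Types (mu nu : nat -> nat).

(* All functions are compared on 1..N only, so that N can stay fixed while the
   number of permuted points varies. *)
Definition has_cycles n (s : {perm 'I_n}) mu :=
  all (fun i => cyc s i == mu i) (index_iota 1 N.+1).

(** The order of the centralizer of a permutation with [mu i] cycles of each length [i]. *)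
Definition cycle_weight mu := \prod_(1 <= i < N.+1) ((mu i)`! * i ^ (mu i)).

Definition add_cycle nu i k := nu k + (k == i).

Lemma add_cycle_exists mu i : 0 < mu i -> exists nu, mu =1 add_cycle nu i.
Proof.
move=> h; exists (fun k => mu k - (k == i)) => k; rewrite /add_cycle.
by case: eqP => [->|] /=; lia.
Qed.

Lemma cycle_weight_add nu i : 0 < i <= N ->
  cycle_weight (add_cycle nu i) = (nu i).+1 * i * cycle_weight nu.
Proof.
move=> hi; rewrite /cycle_weight !(bigD1_seq i) ?mem_index_iota ?iota_uniq //=.
rewrite /add_cycle eqxx addn1 factS expnS -!mulnA; congr (_ * _).
rewrite mulnCA; congr (_ * (_ * (_ * _))).
by apply: eq_bigr => k /negPf ->; rewrite addn0.
Qed.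

Lemma wsum_add_cycle nu i : 0 < i <= N ->
  \sum_(1 <= k < N.+1) k * add_cycle nu i k = \sum_(1 <= k < N.+1) k * nu k + i.
Proof.
move=> hi; rewrite !(bigD1_seq i) ?mem_index_iota ?iota_uniq //=.
rewrite /add_cycle eqxx addn1 mulnS -addnA addnC; congr (_ + _ + _).
by apply: eq_bigr => k /negPf ->; rewrite addn0.
Qed.

Lemma eq_has_cycles n (s : {perm 'I_n}) mu nu :
  mu =1 nu -> has_cycles s mu = has_cycles s nu.
Proof. by move=> e; apply: eq_all => i; rewrite e. Qed.

Lemma eq_cycle_weight mu nu : mu =1 nu -> cycle_weight mu = cycle_weight nu.
Proof. by move=> e; apply: eq_bigr => i _; rewrite e. Qed.

Lemma eq_wsum mu nu : mu =1 nu ->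
  \sum_(1 <= k < N.+1) k * mu k = \sum_(1 <= k < N.+1) k * nu k.
Proof. by move=> e; apply: eq_bigr => i _; rewrite e. Qed.

Lemma has_cyclesP n (s : {perm 'I_n}) mu :
  reflect (forall i, 0 < i <= N -> cyc s i = mu i) (has_cycles s mu).
Proof.
apply: (iffP allP) => h i; first by move=> hi; apply/eqP/h; rewrite mem_index_iota.
by rewrite mem_index_iota ltnS => hi; apply/eqP/h.
Qed.

(** Induction by removing [ord0], which is either fixed or lies on a cycle of length [a + 1] that
    shrinks to length [a]. After multiplication by the weight, the first kind contributes
    [n! * mu 1] and the second [n! * (a + 1) * mu (a + 1)] for each [a]; the sum is [n!] times the
    weighted sum [n + 1]. *)
Lemma card_has_cycles n mu : n <= N -> \sum_(1 <= k < N.+1) k * mu k = n ->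
  #|[pred s : {perm 'I_n} | has_cycles s mu]| * cycle_weight mu = n`!.
Proof.
elim: n mu => [|n IH] mu nN smu.
  have mu0 i : 0 < i <= N -> mu i = 0.
    move=> hi; apply/eqP; have := leqnn (\sum_(1 <= k < N.+1) k * mu k).
    rewrite {2}smu (bigD1_seq i) ?mem_index_iota ?iota_uniq //= leqn0 addn_eq0.
    by rewrite muln_eq0 => /andP[/orP[]// h _]; move: hi; rewrite (eqP h).
  rewrite /cycle_weight big_nat_cond big1 ?muln1 => [|i]; last first.
    by rewrite andbT ltnS => /mu0 ->.
  rewrite fact0 (eq_card (B := predT)) ?card_Sn //.
  move=> s; rewrite !inE; apply/has_cyclesP => i /mu0 ->.
  apply/eqP; rewrite /cyc (eq_card (B := pred0)) ?card0 ?div0n //.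
  by case.
have typ0 (s : {perm 'I_n}) nu : mu =1 add_cycle nu 1 ->
    has_cycles (insert_perm s ord0) mu = has_cycles s nu.
  move=> e; rewrite (eq_has_cycles _ e); apply/has_cyclesP/has_cyclesP => h i hi.
    by have := h i hi; rewrite cyc_insert0 ?(andP hi).1 // => /addIn.
  by rewrite cyc_insert0 ?(andP hi).1 // h.
have typx (s : {perm 'I_n}) x nu : mu =1 add_cycle nu (forder s x).+1 ->
    has_cycles (insert_perm s (lift ord0 (s x))) mu = has_cycles s (add_cycle nu (forder s x)).
  move=> e; rewrite (eq_has_cycles _ e); apply/has_cyclesP/has_cyclesP => h i hi.
    by have := cyc_insert s x (proj1 (andP hi)); rewrite h // /add_cycle; lia.
  by have := cyc_insert s x (proj1 (andP hi)); rewrite h // /add_cycle; lia.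
have -> : #|[pred s : {perm 'I_n.+1} | has_cycles s mu]| =
    \sum_(s : {perm 'I_n}) (has_cycles (insert_perm s ord0) mu : nat) +
    \sum_(s : {perm 'I_n}) \sum_x (has_cycles (insert_perm s (lift ord0 (s x))) mu : nat).
  rewrite -sum_bool_card (reindex _ (onW_bij _ (insert_perm_bij n))) /=.
  rewrite -(pair_bigA _ (fun s j => has_cycles (insert_perm s j) mu : nat)) /=.
  rewrite -big_split; apply: eq_bigr => s _ /=.
  rewrite big_ord_recl; congr (_ + _).
  by rewrite (reindex_inj (@perm_inj _ s)).
rewrite mulnDl.
have -> : (\sum_(s : {perm 'I_n}) (has_cycles (insert_perm s ord0) mu : nat)) * cycle_weight mu
    = n`! * mu 1.
  case: (posnP (mu 1)) => [m0|/add_cycle_exists[nu e]].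
    rewrite m0 muln0 big1 // => s _; apply/eqP; rewrite eqb0; apply/has_cyclesP.
    move=> /(_ 1); rewrite cyc_insert0 // m0 addn1 => /(_ _)/eqP; rewrite /=.
    by apply/implyP; lia.
  rewrite (eq_bigr (fun s => has_cycles s nu : nat)) => [|s _]; last by rewrite (typ0 _ nu).
  rewrite sum_bool_card (eq_cycle_weight e) cycle_weight_add ?(leq_trans _ nN) //.
  rewrite e /add_cycle eqxx addn1 muln1 mulnCA mulnC; congr (_ * _); apply: IH; first exact: ltnW.
  by move: smu; rewrite (eq_wsum e) wsum_add_cycle ?addn1 ?(leq_trans _ nN) // => -[].
have -> : (\sum_(s : {perm 'I_n}) \sum_x
    (has_cycles (insert_perm s (lift ord0 (s x))) mu : nat)) * cycle_weight mu
    = \sum_(1 <= a < N) n`! * (a.+1 * mu a.+1).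
  have oN (s : {perm 'I_n}) x : 1 <= forder s x < N.
    rewrite fingraph.order_gt0 /= (leq_ltn_trans _ nN) //.
    by apply: leq_trans (max_card _) _; rewrite card_ord.
  transitivity (\sum_(1 <= a < N) (\sum_(s : {perm 'I_n}) \sum_(x | forder s x == a)
       (has_cycles (insert_perm s (lift ord0 (s x))) mu : nat)) * cycle_weight mu).
    rewrite -big_distrl /=; congr (_ * _).
    rewrite [RHS]exchange_big /=; apply: eq_bigr => s _.
    rewrite [RHS](exchange_big_dep xpredT) //=; apply: eq_bigr => x _.
    rewrite -big_filter (_ : [seq _ <- _ | _] = [:: forder s x]) ?big_seq1 //.
    rewrite (eq_filter (a2 := pred1 (forder s x))); last by move=> b; apply: eq_sym.
    by rewrite filter_pred1_uniq ?iota_uniq // mem_index_iota.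
  rewrite big_nat [RHS]big_nat; apply: eq_bigr => a /andP[a0 aN].
  case: (posnP (mu a.+1)) => [m0|/add_cycle_exists[nu e]].
    rewrite m0 !muln0 big1 // => s _; rewrite big1 // => x /eqP ox.
    apply/eqP; rewrite eqb0; apply/has_cyclesP => /(_ a.+1 aN) h.
    by have := cyc_insert s x (ltn0Sn a); rewrite h m0 ox eqxx; lia.
  (* A permutation [s] of the shrunken type has [(nu a).+1 * a] points on [a]-cycles, and each is a
     place to insert the new point. *)
  have -> : \sum_(s : {perm 'I_n}) \sum_(x | forder s x == a)
       (has_cycles (insert_perm s (lift ord0 (s x))) mu : nat)
     = \sum_(s : {perm 'I_n}) has_cycles s (add_cycle nu a) * ((nu a).+1 * a).
    apply: eq_bigr => s _.
    rewrite (eq_bigr (fun=> has_cycles s (add_cycle nu a) : nat)) => [|x /eqP ox]; last first.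
      by rewrite (typx _ _ nu) ox.
    rewrite sum_nat_const mulnC; case: has_cyclesP => // h.
    have := cycM a (@perm_inj _ s); rewrite h ?a0 1?ltnW // /add_cycle eqxx addn1 => ->.
    by congr (_ * _); apply: eq_card.
  rewrite -big_distrl /= sum_bool_card (eq_cycle_weight e) cycle_weight_add //.
  rewrite -(IH (add_cycle nu a)); last 2 first.
  - exact: ltnW.
  - move: smu; rewrite (eq_wsum e) !wsum_add_cycle ?a0 1?ltnW // addnS; case=> <-; lia.
  rewrite cycle_weight_add ?a0 1?ltnW // e /add_cycle eqxx addn1.
  move: (cycle_weight nu) => z; set c := #|_|; ring.
rewrite factS -smu [in RHS]big_ltn ?ltnS; last by apply: leq_trans nN.
rewrite mul1n mulnDl mulnC; congr (_ + _).
by rewrite [in RHS]big_add1 -big_distrr /= [LHS]mulnC.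
Qed.

End CountByType.

(** * Sums over permutations as sums over partitions *)

Section SumByType.
Variable r : nat.

Lemma mult_ord (k : {ffun 'I_r -> 'I_r.+1}) (i : 'I_r) : mult k i.+1 = k i.
Proof. by rewrite /mult valK. Qed.

Lemma parts_wsum (k : {ffun 'I_r -> 'I_r.+1}) :
  (k \in parts r) = (\sum_(1 <= i < r.+1) i * mult k i == r).
Proof.
rewrite inE big_add1 big_mkord; congr (_ == _).
by apply: eq_bigr => i _; rewrite mult_ord.
Qed.

Lemma has_cycles_mult (s : {perm 'I_r}) (k k' : {ffun 'I_r -> 'I_r.+1}) :
  has_cycles r s (mult k) -> has_cycles r s (mult k') -> k = k'.
Proof.
move=> /has_cyclesP h /has_cyclesP h'; apply/ffunP => i; apply: val_inj => /=.
have hi : 0 < i.+1 <= r by rewrite ltn_ord.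
by rewrite -!mult_ord -h // -h'.
Qed.

Lemma order_bounds (s : {perm 'I_r}) x : 0 < forder s x <= r.
Proof.
rewrite fingraph.order_gt0 /=.
by apply: leq_trans (max_card _) _; rewrite card_ord.
Qed.

Lemma big_by_order (R : Type) (idx : R) (op : Monoid.com_law idx)
    (s : {perm 'I_r}) (F : 'I_r -> R) :
  \big[op/idx]_x F x =
  \big[op/idx]_(1 <= a < r.+1) \big[op/idx]_(x | forder s x == a) F x.
Proof.
rewrite [RHS](exchange_big_dep xpredT) //=; apply: eq_bigr => x _.
rewrite -[RHS]big_filter (eq_filter (a2 := pred1 (forder s x))); last first.
  by move=> b; apply: eq_sym.
by rewrite filter_pred1_uniq ?iota_uniq ?mem_index_iota ?order_bounds // big_seq1.
Qed.

Lemma wsum_cyc (s : {perm 'I_r}) : \sum_(1 <= i < r.+1) i * cyc s i = r.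
Proof.
transitivity (\sum_(x : 'I_r) 1); last by rewrite sum1_card card_ord.
rewrite (big_by_order _ s); apply: eq_bigr => i _.
by rewrite sum1_card mulnC cycM //; apply: perm_inj.
Qed.

(** [inord] loses nothing: [r] points carry at most [r] cycles of any given length. *)
Definition cycle_type (s : {perm 'I_r}) : {ffun 'I_r -> 'I_r.+1} :=
  [ffun i : 'I_r => inord (cyc s i.+1)].

Lemma has_cycle_type (s : {perm 'I_r}) : has_cycles r s (mult (cycle_type s)).
Proof.
apply/has_cyclesP => -[//|i] ir; rewrite (mult_ord _ (Ordinal ir)) ffunE inordK //=.
rewrite ltnS /cyc (leq_trans (leq_div _ _)) //.
by apply: leq_trans (max_card _) _; rewrite card_ord.
Qed.

Lemma cycle_type_parts (s : {perm 'I_r}) : cycle_type s \in parts r.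
Proof.
rewrite parts_wsum -[X in _ == X](wsum_cyc s); apply/eqP.
apply: eq_big_nat => i hi; congr (_ * _); symmetry.
by move/has_cyclesP: (has_cycle_type s); apply.
Qed.

Lemma zc_gt0 (k : {ffun 'I_r -> 'I_r.+1}) : 0 < zc k.
Proof.
rewrite /zc big_nat_cond; apply: (big_ind (fun m => 0 < m)) => // [m1 m2 h1 h2|i].
  by rewrite muln_gt0 h1.
by rewrite andbT => /andP[i0 _]; rewrite muln_gt0 fact_gt0 expn_gt0 i0.
Qed.

Local Open Scope ring_scope.

(** By [card_has_cycles], exactly [r! / zc k] permutations have type [k]. *)
Lemma sum_cycle_type (F : {perm 'I_r} -> rat) (G : {ffun 'I_r -> 'I_r.+1} -> rat) :
  (forall s, F s = G (cycle_type s)) ->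
  \sum_s F s = r`!%:R * \sum_(k in parts r) (zc k)%:R^-1 * G k.
Proof.
move=> FG; rewrite (partition_big cycle_type (mem (parts r))) /=; last first.
  by move=> s _; apply: cycle_type_parts.
rewrite big_distrr /=; apply: eq_bigr => k kr.
rewrite (eq_bigr (fun=> G k)) => [|s /eqP <-]; last exact: FG.
rewrite sumr_const mulrA -[LHS]mulr_natl; congr (_ * _)%R.
apply: (canRL (mulfK _)); first by rewrite pnatr_eq0 -lt0n zc_gt0.
rewrite -natrM; congr (_%:R).
rewrite -(card_has_cycles (leqnn r) (mu := mult k)); last first.
  by apply/eqP; rewrite -parts_wsum.
congr (_ * _)%N; apply: eq_card => s.
suff : (cycle_type s == k) = has_cycles r s (mult k) by [].
apply/eqP/idP => [<-|]; first exact: has_cycle_type.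
by apply: has_cycles_mult; apply: has_cycle_type.
Qed.

End SumByType.

(** * Maps fixed by a pair of permutations *)

Lemma iter_eq_mod (T : finType) (f : T -> T) (x : T) m n :
  injective f -> (iter m f x == iter n f x) = (m == n %[mod forder f x]).
Proof.
move=> injf; wlog: m n / n <= m.
  by move=> W; case: (leqP n m) => [/W //|/ltnW /W]; rewrite eq_sym => ->; rewrite eq_sym.
move=> nm; rewrite eqn_mod_dvd // -iter_order_dvd // -{1}(subnKC nm) iterD.
have injn : injective (iter n f) by elim: (n) => //= k IH u v /injf /IH.
by rewrite (inj_eq injn).
Qed.

Lemma card_option_pred (T : finType) (P : pred (option T)) :
  #|P| = P None + #|[pred x | P (Some x)]|.
Proof.
have sI : injective (@Some T) by move=> x y [].
rewrite (cardD1 None) -(card_image sI); congr (_ + _); apply: eq_card => y.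
apply/idP/imageP => [|[x Px ->]]; last by rewrite !inE.
by rewrite !inE; case: y => // x Px; exists x.
Qed.

(** Covers also the lengths beyond [r], which occur in [Cc]: there are no such cycles, and [mult] is
    0 there by convention. *)
Lemma mult_cycle_type r (s : {perm 'I_r}) d : 0 < d ->
  mult (cycle_type s) d = cyc s d.
Proof.
move=> d0; case: (leqP d r) => dr.
  by symmetry; move/has_cyclesP: (has_cycle_type s); apply; rewrite d0.
have -> : cyc s d = 0.
  rewrite /cyc (eq_card (B := pred0)) ?card0 ?div0n // => x; rewrite !inE.
  by apply/negbTE/eqP => e; have /andP[_] := order_bounds s x; rewrite e leqNgt dr.
case: d d0 dr => // d _ dr; rewrite /mult insubF //.
by apply/negbTE; rewrite -leqNgt.
Qed.

Lemma card_order_dvd (T : finType) (f : T -> T) k : injective f -> 0 < k ->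
  #|[pred x | forder f x %| k]| = \sum_(1 <= d < k.+1 | d %| k) d * cyc f d.
Proof.
move=> injf k0; rewrite -sum_bool_card /=.
rewrite (eq_bigr (fun d => \sum_x (forder f x == d : nat))) => [|d _]; last first.
  by rewrite mulnC cycM // -sum_bool_card.
rewrite exchange_big /=; apply: eq_bigr => x _.
rewrite big_mkcond /=.
rewrite (eq_bigr (fun d => (forder f x %| k) * (forder f x == d))) => [|d _]; last first.
  by case: eqP => [->|]; rewrite ?muln0 ?muln1; case: ifP.
rewrite -big_distrr /=; case: (boolP (_ %| k)) => // ok; rewrite mul1n.
rewrite (bigD1_seq (forder f x)) ?iota_uniq ?mem_index_iota //=; last first.
  by rewrite fingraph.order_gt0 ltnS dvdn_leq.
by rewrite eqxx big1 // => d /negPf; rewrite eq_sym => ->.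
Qed.

(** [None] is always fixed, which is the leading 1 of [Cc]; any other point is fixed by the [k]-th
    iterate exactly when its cycle length divides [k]. *)
Lemma nfix_omap b (t : {perm 'I_b}) k : 0 < k ->
  nfix (omap t) k = Cc (cycle_type t) k.
Proof.
move=> k0; rewrite /nfix /Cc card_option_pred.
have it x : iter k (omap t) (Some x) = Some (iter k t x) by elim: k {k0} => //= k ->.
have i0 : iter k (omap t) None = None by elim: k {k0 it} => //= k ->.
rewrite /= i0 eqxx; congr (_ + _).
transitivity #|[pred x | forder t x %| k]|.
  apply: eq_card => x; rewrite !inE it -iter_order_dvd //; exact: perm_inj.
rewrite card_order_dvd //; last exact: perm_inj.
rewrite big_nat_cond [RHS]big_nat_cond; apply: eq_bigr => d /andP[/andP[d0 _] _].
by rewrite mult_cycle_type.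
Qed.

Lemma prod_pair (A B : finType) (F : A * B -> nat) :
  \prod_p F p = \prod_x \prod_y F (x, y).
Proof. by rewrite pair_bigA; apply: eq_bigr => -[]. Qed.

Section FixedFunctions.
Variables (r b : nat) (s : {perm 'I_r}) (t : {perm 'I_b}).
Let k := cycle_type s.
Let j := cycle_type t.
Let sI : injective s := @perm_inj _ s.

Definition swap_if (e : bool) (p : 'I_r * 'I_r) := if e then (p.2, p.1) else p.
Definition act_pair (e : bool) p := let q := swap_if e p in (s q.1, s q.2).

Lemma act_pair_inj e : injective (act_pair e).
Proof. by case: e => -[x y] [x' y'] [] /sI -> /sI ->. Qed.

Lemma card_order_set (a : nat) : 0 < a -> #|[pred x | forder s x == a]| = mult k a * a.
Proof. by move=> a0; rewrite /k mult_cycle_type // cycM //. Qed.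

Lemma order_dvd_fact x : forder s x %| r`!.
Proof. by rewrite dvdn_fact ?order_bounds. Qed.

Lemma order_act_pair x y :
  forder (act_pair false) (x, y) = lcmn (forder s x) (forder s y).
Proof.
apply: order_eq_dvd => [|n]; first exact: act_pair_inj.
have -> : iter n (act_pair false) (x, y) = (iter n s x, iter n s y).
  by elim: n => //= n ->.
by rewrite dvdn_lcm -!iter_order_dvd.
Qed.

Lemma prod_by_orders (F : nat -> nat -> nat) :
  \prod_x \prod_y F (forder s x) (forder s y) =
  \prod_(1 <= a < r.+1) \prod_(1 <= c < r.+1)
     F a c ^ (mult k a * mult k c * (a * c)).
Proof.
rewrite (big_by_order _ s); apply: eq_big_nat => a /andP[a0 _].
rewrite (eq_bigr (fun=> \prod_(1 <= c < r.+1) F a c ^ (mult k c * c)));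
  last first => [x /eqP ->|].
  rewrite (big_by_order _ s); apply: eq_big_nat => c /andP[c0 _].
  by rewrite -card_order_set // -prod_nat_const; apply: eq_big => // y /eqP ->.
rewrite prod_nat_const card_order_set // expn_prod.
by apply: eq_bigr => c _; rewrite -expnM; congr (_ ^ _); ring.
Qed.

(** A common multiple of all periods of pairs; the factor 2 serves the swapped action. *)
Let M := 2 * r`!.

(** A pair of points with cycle lengths [a] and [c] has period [lcmn a c], so two such cycles carry
    [gcdn a c] cycles of pairs. Comparing [M]-th powers replaces the product over cycles by one over
    points, without choosing representatives. *)
Lemma fixed_noswap :
  #|equivariant_fns (act_pair false) (omap t)| =
  \prod_(1 <= a < r.+1) \prod_(1 <= c < r.+1)
     Cc j (lcmn a c) ^ (mult k a * mult k c * gcdn a c).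
Proof.
have M0 : 0 < M by rewrite muln_gt0 fact_gt0.
apply/eqP; rewrite -(eqn_exp2r _ _ M0); apply/eqP.
rewrite (card_equiv_exp (omap t) (@act_pair_inj false) None (M := M)); last first.
  by case=> x y; rewrite order_act_pair dvdn_mull // dvdn_lcm !order_dvd_fact.
rewrite prod_pair.
under eq_bigr => x _ do under eq_bigr => y _ do rewrite order_act_pair.
rewrite (prod_by_orders (fun a c => nfix (omap t) (lcmn a c) ^ (M %/ lcmn a c))).
rewrite expn_prod; apply: eq_big_nat => a /andP[a0 ar].
rewrite expn_prod; apply: eq_big_nat => c /andP[c0 cr].
have l0 : 0 < lcmn a c by rewrite lcmn_gt0 a0.
have lM : lcmn a c %| M.
  by rewrite dvdn_mull // dvdn_lcm !dvdn_fact ?a0 ?c0.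
rewrite nfix_omap // -!expnM -(muln_lcm_gcd a c); congr (_ ^ _).
rewrite -[in RHS](divnK lM).
ring.
Qed.

Lemma iter_swap n x y : iter n (act_pair true) (x, y) =
  if odd n then (iter n s y, iter n s x) else (iter n s x, iter n s y).
Proof. by elim: n => //= n ->; case: (odd n). Qed.

(* Period of (x, s^d x) under (x, y) |-> (s y, s x) when x lies on an
   a-cycle of s and d < a. *)
Definition swap_period a d :=
  if odd a then (if d == 0 then a else 2 * a)
  else if 4 %| a then a else if d == a %/ 2 then a %/ 2 else a.

(** The left side says that [n] steps return [(x, s^d x)] to itself. For odd [n] this means that [n]
    is congruent to both [d] and [-d] modulo [a], so [a] divides [2 * d]. For odd [a] only [d = 0]
    remains; for even [a] the shift [d] must be odd, which leaves [d = a / 2] with [a] congruent to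
    2 modulo 4. *)
Lemma swap_periodP a d n : 0 < a -> d < a ->
  (if odd n then (a %| n + d) && (n == d %[mod a]) else a %| n)
  = (swap_period a d %| n).
Proof.
move=> a0 da; rewrite /swap_period.

have key : odd n -> a %| n + d -> n = d %[mod a] -> a %| 2 * d.
  move=> _ h e; rewrite mul2n -addnn /dvdn -modnDml -e modnDml //.
have ha : odd n -> 2 %| a -> ~~ (a %| n).
  by move=> on /dvdnP[q ->]; apply/dvdnP => -[q' e]; move: on; rewrite e mulnA oddM andbF.
case: (boolP (odd a)) => [oa|ea].
  case: (eqVneq d 0) => [->|d0].
    by rewrite addn0; case: ifP => // _; rewrite mod0n -[_ == 0]/(a %| n) andbb.
  rewrite Gauss_dvd ?coprime2n // dvdn2; case: ifPn => on //=.
  apply/negP => /andP[h /eqP e]; have := key on h e.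
  rewrite Gauss_dvdr ?coprimen2 // => /dvdn_leq; rewrite lt0n d0 => /(_ isT).
  by rewrite leqNgt da.
have a2 : 2 %| a by rewrite dvdn2.
have evd : odd n -> a %| n + d -> odd d.
  by move=> on /(dvdn_trans a2); rewrite dvdn2 oddD on /=; case: (odd d).
(* With [2 * d = q * a], the bound [d < a] gives [q < 2], and [q = 0] is excluded because [d] is
   odd. *)
have d_half : odd n -> a %| n + d -> n = d %[mod a] -> d = a %/ 2.
  move=> on h e; have od := evd on h; have /dvdnP[q eq] := key on h e.
  have q2 : q < 2 by rewrite -(ltn_pmul2r a0) -eq ltn_pmul2l.
  have q1 : q = 1 by move: q2 eq od; case: q => [|[]] // _ /eqP; rewrite muln_eq0 => /eqP ->.
  by move: eq; rewrite q1 mul1n => <-; rewrite mulKn.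
case: (boolP (4 %| a)) => [a4|na4].
  case: ifPn => // on; rewrite (negPf (ha on a2)); apply/negP => /andP[h /eqP e].
  have := evd on h; rewrite (d_half on h e); move: a4 => /dvdnP[q ->].
  by rewrite (_ : 4 = 2 * 2) // mulnA mulnK // mulnC oddM.
have /dvdnP[c ec] := a2; have ha2 : a %/ 2 = c by rewrite ec mulnK.
have oc : odd c.
  by apply: contraR na4 => nc; rewrite ec (_ : 4 = 2 * 2) // dvdn_pmul2r // dvdn2.
case: (eqVneq d (a %/ 2)) => [->|dn]; last first.
  case: ifPn => // on; rewrite (negPf (ha on a2)); apply/negP => /andP[h /eqP e].
  by rewrite (d_half on h e) eqxx in dn.
rewrite ha2; case: ifPn => on; last first.
  by rewrite ec mulnC Gauss_dvd ?coprime2n // dvdn2 on.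
(* Here [a = 2 * c] and [d = c] with [c] odd: for odd [n], both congruences modulo [2 * c] say that
   [n] is an odd multiple of [c]. *)
apply/andP/idP => [[h _]|/dvdnP[q eq]].
  have := dvdn_trans (dvdn_mulr 2 (dvdnn c)) (_ : c * 2 %| _).
  by rewrite -ec => /(_ _ h); rewrite dvdn_addl.
have oq : odd q by move: on; rewrite eq oddM oc andbT.
have [q' e'] : exists q', q = 2 * q' + 1.
  by exists q./2; rewrite -[LHS]odd_double_half oq mul2n addnC.
rewrite eq e' ec; split.
  by apply/dvdnP; exists (q' + 1); ring.
by rewrite (_ : (2 * q' + 1) * c = q' * (c * 2) + c) ?modnMDl //; ring.
Qed.

(** An odd number of steps exchanges the two cycles, so a return time is even, besides being a
    multiple of both cycle lengths. *)
Lemma order_act_swap_other x y : ~~ fconnect s x y ->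
  forder (act_pair true) (x, y) = lcmn 2 (lcmn (forder s x) (forder s y)).
Proof.
move=> nxy; apply: order_eq_dvd => [|n]; first exact: act_pair_inj.
rewrite iter_swap !dvdn_lcm dvdn2 -!iter_order_dvd //.
case: ifPn => on //; rewrite xpair_eqE; apply/negbTE; rewrite negb_and.
apply/orP; right; apply: contra nxy => /eqP <-; exact: fconnect_iter.
Qed.

Lemma order_act_swap_same x d : d < forder s x ->
  forder (act_pair true) (x, iter d s x) = swap_period (forder s x) d.
Proof.
move=> dx; apply: order_eq_dvd => [|n]; first exact: act_pair_inj.
rewrite iter_swap -swap_periodP ?fingraph.order_gt0 //.
have oy := order_fconnect sI (fconnect_iter s d x).
case: ifPn => on; rewrite xpair_eqE.
  by rewrite -iterD iter_order_dvd // iter_eq_mod.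
by rewrite !iter_order_dvd // oy andbb.
Qed.

(** At most one shift is exceptional, [d = 0] for odd [a] and [d = a / 2] for [a] congruent to 2
    modulo 4; this produces the three cases of [qa]. The exponent [2 * a * m] stands for [M]. *)
Lemma prod_swap_period a m (C : nat -> nat) : 0 < a ->
  \prod_(d < a) C (swap_period a d) ^ ((2 * a * m) %/ swap_period a d)
  = (if odd a then C a * C (2 * a) ^ ((a - 1) %/ 2)
     else if 4 %| a then C a ^ a
     else C (a %/ 2) ^ 2 * C a ^ (a - 1)) ^ (2 * m).
Proof.
move=> a0; rewrite /swap_period; have e1 : (2 * a * m) %/ a = 2 * m.
  by rewrite mulnAC mulnK.
case: ifPn => [oa|ea].
  rewrite (bigD1 (Ordinal a0)) //= e1 (eq_bigr (fun=> C (2 * a) ^ m)) => [|d /negPf d0].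
    rewrite prod_nat_const cardC1 card_ord expnMn; congr (_ * _).
    rewrite -!expnM; congr (_ ^ _).
    have : a.-1 = (a - 1) %/ 2 * 2 by rewrite divnK ?subn1 // dvdn2 -subn1 oddB ?oa.
    by move=> ->; ring.
  rewrite ifF; last by apply: contraFF d0 => /eqP h; apply/eqP/val_inj.
  by rewrite mulKn // muln_gt0.
case: ifPn => [a4|na4].
  by rewrite prod_nat_const card_ord e1 -!expnM mulnC.
have h0 : a %/ 2 < a by rewrite ltn_Pdiv.
have h1 : 0 < a %/ 2 by rewrite divn_gt0 //; case: (a) ea a0 => [|[]].
rewrite (bigD1 (Ordinal h0)) //= eqxx (eq_bigr (fun=> C a ^ (2 * m))) => [|d /negPf d0].
  rewrite prod_nat_const cardC1 card_ord expnMn -!expnM; congr (_ * _ ^ _).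
    congr (_ ^ _); rewrite -{1}(@divnK 2 a) ?dvdn2 //.
    by rewrite (_ : 2 * (a %/ 2 * 2) * m = 2 * (2 * m) * (a %/ 2)) ?mulnK //; ring.
  by rewrite subn1; ring.
by rewrite ifF ?e1 //; apply: contraFF d0 => /eqP h; apply/eqP/val_inj.
Qed.

Lemma prod_fconnect x (F : 'I_r -> nat) :
  \prod_(y | fconnect s x y) F y = \prod_(d < forder s x) F (iter d s x).
Proof.
rewrite (eq_bigl (mem (fingraph.orbit s x))) => [|y]; last by rewrite /= -fconnect_orbit.
rewrite -big_uniq ?orbit_uniq //= (big_nth x) size_orbit big_mkord.
by apply: eq_bigr => d _; rewrite nth_traject.
Qed.

(** The subtracted term removes the cycle of [x] itself, which is present only at its own length. *)
Lemma prod_not_fconnect x (F : nat -> nat) :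
  \prod_(y | ~~ fconnect s x y) F (forder s y) =
  \prod_(1 <= c < r.+1) F c ^ (mult k c * c - (c == forder s x) * c).
Proof.
rewrite big_mkcond (big_by_order _ s); apply: eq_big_nat => c /andP[c0 _].
rewrite -big_mkcondr (eq_bigr (fun=> F c)) => [|y /andP[/eqP-> _]] //.
rewrite prod_nat_const -card_order_set //; congr (_ ^ _).
rewrite -(cardID (fconnect s x) [pred y | forder s y == c]) addnC.
rewrite (_ : (c == forder s x) * c = #|[predI [pred y | forder s y == c] & fconnect s x]|).
  by rewrite addnK; apply: eq_card => y; rewrite !inE andbC.
case: eqP => [->|ne]; rewrite ?mul1n ?mul0n.
  apply: eq_card => y.
  suff : fconnect s x y = (forder s y == forder s x) && fconnect s x y by [].
  by case: (boolP (fconnect s x y)) => xy; rewrite ?andbF // (order_fconnect sI xy) eqxx.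
symmetry; apply: eq_card0 => y; rewrite !inE; apply/negbTE/negP => /andP[/eqP oy].
by move=> /(order_fconnect sI) xy; case: ne; rewrite -oy.
Qed.

Lemma prod_symmetric n (H : nat -> nat -> nat) : (forall a c, H a c = H c a) ->
  \prod_(1 <= a < n.+1) \prod_(1 <= c < n.+1) H a c =
  \prod_(1 <= a < n.+1) (H a a * \prod_(1 <= c < a) H a c ^ 2).
Proof.
move=> sH; elim: n => [|n IH]; first by rewrite !big_nil.
rewrite big_nat_recr //= [RHS]big_nat_recr //= -IH.
rewrite (eq_bigr (fun a => \prod_(1 <= c < n.+1) H a c * H a n.+1)) => [|a _]; last first.
  by rewrite big_nat_recr.
rewrite big_split [\prod_(1 <= i < n.+2) _]big_nat_recr //= -!mulnA; congr (_ * _).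
rewrite mulnA -big_split /= mulnC; congr (_ * _).
by apply: eq_bigr => a _; rewrite sH mulnn.
Qed.

(** Pairs within one cycle yield [qa]. Pairs on different cycles have period [lcm(2, a, c)] and
    yield [ppow]: there are [k_a^2 - k_a] ordered pairs of distinct [a]-cycles, and [2 * k_a * k_c]
    ordered pairs of cycles of lengths [a] and [c] when [c < a]. Again [M]-th powers are
    compared. *)
Lemma fixed_swap :
  #|equivariant_fns (act_pair true) (omap t)| =
  \prod_(1 <= a < r.+1)
     (qa j a ^ mult k a * ppow j a a (mult k a ^ 2 - mult k a) *
      \prod_(1 <= c < a) ppow j a c (2 * mult k a * mult k c)).
Proof.
have M0 : 0 < M by rewrite muln_gt0 fact_gt0.
have same x y : fconnect s x y -> exists2 d, d < forder s x & y = iter d s x.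
  by move=> xy; exists (findex s x y); [apply: findex_max | rewrite iter_findex].
have swap_dvd a d : 0 < a -> swap_period a d %| 2 * a /\ 0 < swap_period a d.
  move=> a0; rewrite /swap_period; case: (boolP (odd a)) => [_|ea].
    by case: ifP => _; split; rewrite ?dvdnn ?dvdn_mull ?muln_gt0.
  have a2 : 2 %| a by rewrite dvdn2.
  case: ifP => _; first by split; rewrite ?dvdn_mull.
  case: ifP => _; split; rewrite ?divn_gt0 ?(dvdn_leq a0) // dvdn_mull //.
  by rewrite -{2}(divnK a2) dvdn_mulr.
have a_dvd a : 0 < a <= r -> a %| r`! by apply: dvdn_fact.
pose l a c := lcmn 2 (lcmn a c).
have lM a c : 0 < a <= r -> 0 < c <= r -> l a c %| M.
  by move=> ha hc; rewrite dvdn_lcm dvdn_mulr // dvdn_mull // dvdn_lcm !a_dvd.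
have orderM p : forder (act_pair true) p %| M.
  case: p => x y; case: (boolP (fconnect s x y)) => [/same[d dx ->]|/order_act_swap_other->].
    rewrite order_act_swap_same // (dvdn_trans (swap_dvd _ _ _).1) ?fingraph.order_gt0 //.
    by rewrite dvdn_pmul2l // order_dvd_fact.
  by rewrite lM ?order_bounds.
apply/eqP; rewrite -(eqn_exp2r _ _ M0); apply/eqP.
rewrite (card_equiv_exp (omap t) (@act_pair_inj true) None (M := M)) // prod_pair.
pose F a c := Cc j (l a c) ^ (M %/ l a c).
(* The share of a point [x] on an [a]-cycle: all pairs [(x, y)], first with [y] on the same cycle,
   then with [y] elsewhere. *)
pose G a := qa j a ^ (M %/ a) *
  \prod_(1 <= c < r.+1) F a c ^ (mult k c * c - (c == a) * c).
transitivity (\prod_x G (forder s x)).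
  apply: eq_bigr => x _; rewrite (bigID (fconnect s x)) /=; congr (_ * _).
    rewrite prod_fconnect; set a := forder s x.
    have a0 : 0 < a by apply: fingraph.order_gt0.
    have eM : M = 2 * a * (r`! %/ a) by rewrite -mulnA [a * _]mulnC divnK ?order_dvd_fact.
    rewrite (_ : M %/ a = 2 * (r`! %/ a)); last by rewrite eM mulnAC mulnK.
    rewrite -(prod_swap_period _ _ a0) -eM; apply: eq_bigr => d _.
    by rewrite order_act_swap_same // nfix_omap // (swap_dvd _ _ a0).2.
  rewrite -prod_not_fconnect; apply: eq_bigr => y nxy.
  by rewrite order_act_swap_other // nfix_omap // !lcmn_gt0 !fingraph.order_gt0.
transitivity (\prod_(1 <= a < r.+1) G a ^ (mult k a * a)).
  rewrite (big_by_order _ s); apply: eq_big_nat => a /andP[a0 _].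
  by rewrite -card_order_set // -prod_nat_const; apply: eq_bigr => x /eqP->.
pose H a c := F a c ^ ((mult k c * c - (c == a) * c) * (mult k a * a)).
have Hsym a c : H a c = H c a.
  rewrite /H /F /l lcmnC [lcmn a c]lcmnC [lcmn _ 2]lcmnC [c == a]eq_sym; case: eqP => [->//|_].
  by congr (_ ^ _); rewrite !mul0n !subn0 mulnC.
rewrite expn_prod (eq_big_nat _ _ (F2 := fun a =>
  (qa j a ^ mult k a) ^ M * \prod_(1 <= c < r.+1) H a c)); last first.
  move=> a /andP[a0 ar]; rewrite /G expnMn -!expnM expn_prod; congr (_ ^ _ * _).
    by rewrite mulnCA divnK // dvdn_mull // a_dvd // a0.
  by apply: eq_bigr => c _; rewrite -expnM.
rewrite big_split /= prod_symmetric // -big_split /=.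
apply: eq_big_nat => a /andP[a0 ar]; rewrite !expnMn expn_prod -mulnA; congr (_ * (_ * _)).
  rewrite /H /F /ppow -!expnM eqxx mul1n; congr (_ ^ _).
  have ha : 0 < a <= r by rewrite a0.
  (* The division inside [ppow] is exact; the factor 2 comes from [k^2 - k] being even. *)
  have la : l a a %| a * a * (mult k a ^ 2 - mult k a).
    rewrite !dvdn_lcm; apply/and3P; split; try by rewrite -mulnA dvdn_mulr.
    rewrite dvdn_mull // dvdn2 oddB ?oddX ?addbb //.
    by rewrite -{1}[mult k a]expn1; case: (mult k a) => // m; rewrite leq_pexp2l.
  rewrite -/(l a a) (divn_mulAC _ la) -(muln_divA _ (lM _ _ ha ha)) mulnC; congr (_ * _).
  case: (mult k a) => [|m]; first by rewrite mul0n !muln0.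
  rewrite mulSn addKn (_ : m.+1 ^ 2 = m.+1 + m.+1 * m) ?addKn; last by rewrite -mulnS.
  by rewrite -!mulnA; ring.
apply: eq_big_nat => c /andP[c0 ca].
have ha : 0 < a <= r by rewrite a0.
have hc : 0 < c <= r by rewrite c0 (leq_trans (ltnW ca)).
have la : l a c %| a * c * (2 * mult k a * mult k c).
  rewrite !dvdn_lcm; apply/and3P; split.
  - by rewrite dvdn_mull // -mulnA dvdn_mulr.
  - by rewrite -!mulnA dvdn_mulr.
  - by rewrite dvdn_mulr // dvdn_mull.
rewrite /H /F /ppow -!expnM -/(l a c) (divn_mulAC _ la) -(muln_divA _ (lM _ _ ha hc)).
rewrite (ltn_eqF ca) mul0n subn0; congr (_ ^ _); ring.
Qed.

End FixedFunctions.

(** * Orbits of maps *)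

Lemma card_perm_type (T : finType) : #|{perm T}| = #|T|`!.
Proof.
rewrite -cardsT -card_perm; apply: eq_card => s.
by rewrite inE; symmetry; apply/subsetP => x; rewrite inE.
Qed.

Section Orbits.
Variables (r b : nat).
Local Notation fn := {ffun 'I_r * 'I_r -> option 'I_b}.
Local Notation grp := ({perm 'I_r} * {perm 'I_b} * {perm bool})%type.

(* [None] stands for the zero z; [{perm bool}] is used as the group of order 2, its
   parity telling whether the arguments are swapped. *)
Definition fn_rel (f g : fn) : bool :=
  [exists s : {perm 'I_r}, exists t : {perm 'I_b}, exists e : bool,
     forall p, g (act_pair s e p) == omap t (f p)].

Lemma fn_relP (f g : fn) :
  reflect (exists s : {perm 'I_r}, exists t : {perm 'I_b}, exists e : bool,
     forall p, g (act_pair s e p) = omap t (f p)) (fn_rel f g).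
Proof.
apply: (iffP existsP) => -[s]; first by
  case/existsP=> t /existsP[e /forallP h]; exists s, t, e => p; apply/eqP.
case=> t [e h]; exists s; apply/existsP; exists t; apply/existsP; exists e.
by apply/forallP => p; rewrite h.
Qed.

(** The inverse makes this a right action; the swap is its own inverse and commutes with [s] acting
    on both coordinates. *)
Definition fn_act (f : fn) (g : grp) : fn :=
  [ffun p => omap g.1.2 (f (act_pair g.1.1^-1%g (odd_perm g.2) p))].

Lemma act_pairM (s s' : {perm 'I_r}) e e' p :
  act_pair s e (act_pair s' e' p) = act_pair (s' * s)%g (e (+) e') p.
Proof. by case: e; case: e'; rewrite /act_pair /= !permM. Qed.

Lemma act_pair1 p : act_pair (1%g : {perm 'I_r}) false p = p.
Proof. by rewrite /act_pair !perm1; case: p. Qed.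

Lemma fn_act_is_action : is_action [set: grp] fn_act.
Proof.
apply: is_total_action => [f|f [[s t] e] [[s' t'] e']].
  apply/ffunP => p; rewrite ffunE /= invg1 odd_perm1 act_pair1.
  by case: (f p) => //= y; rewrite perm1.
apply/ffunP => p; rewrite !ffunE /= act_pairM invMg odd_permM.
by case: (f _) => //= y; rewrite permM.
Qed.

Canonical fn_action := Action fn_act_is_action.

Lemma fn_rel_orbit (f g : fn) : fn_rel f g = (g \in orbit fn_action [set: grp] f).
Proof.
apply/fn_relP/orbitP => [[s [t [e h]]]|[[[s t] e] _ /= <-]].
  exists (s, t, if e then tperm true false else 1%g) => //; apply/ffunP => p.
  rewrite ffunE /= -h act_pairM mulVg.
  by case: e {h}; rewrite ?odd_tperm ?odd_perm1 /= act_pair1.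
exists s, t, e => p; rewrite ffunE /= act_pairM mulgV addbb act_pair1 //.
Qed.

Lemma fn_rel_equiv : equivalence_rel fn_rel.
Proof.
move=> f g h; rewrite !fn_rel_orbit; split; first exact: orbit_refl.
by move=> /orbit_eqP ->.
Qed.

Lemma card_fix s t e : #|'Fix_(setT | fn_action)[(s, t, e) : grp]%g| =
  #|equivariant_fns (act_pair s (odd_perm e)) (omap t)|.
Proof.
apply: eq_card => f; rewrite in_setI in_setT /= [RHS]inE.
apply/afix1P/forallP => [/= /ffunP h p|h].
  by rewrite -(h (act_pair s (odd_perm e) p)) ffunE /= act_pairM mulgV addbb act_pair1.
apply/ffunP => p; rewrite ffunE /= -(eqP (h _)) act_pairM mulVg addbb.
by rewrite act_pair1.
Qed.

Lemma sum_perm_bool (F : bool -> nat) :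
  \sum_(e : {perm bool}) F (odd_perm e) = F false + F true.
Proof.
pose h (c : bool) : {perm bool} := if c then tperm true false else 1%g.
have hK c : odd_perm (h c) = c by case: c; rewrite /h ?odd_tperm ?odd_perm1.
have bh : bijective h.
  apply: inj_card_bij; first exact: can_inj hK.
  by rewrite card_perm_type card_bool.
rewrite (reindex h); last exact: onW_bij.
by rewrite big_bool !hK addnC.
Qed.

Definition num_fn_orbits := #|equivalence_partition fn_rel [set: fn]|.

(** Burnside's lemma for a group of order [r! * b! * 2], with the two parities of the last factor
    summed explicitly. *)
Lemma num_fn_orbitsE : num_fn_orbits * (r`! * b`! * 2) =
  \sum_(s : {perm 'I_r}) \sum_(t : {perm 'I_b})
     (#|equivariant_fns (act_pair s false) (omap t)| +
      #|equivariant_fns (act_pair s true) (omap t)|).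
Proof.
have cG : #|[set: grp]| = r`! * b`! * 2.
  by rewrite cardsT !card_prod !card_perm_type card_bool !card_ord.
have actsG : [acts [set: grp], on [set: fn] | fn_action].
  by rewrite /acts_on; apply/subsetP => g _; rewrite !inE /=; apply/subsetP => f; rewrite !inE.
transitivity (\sum_(g in [set: grp]) #|'Fix_(setT | fn_action)[g]%g|).
  rewrite (Frobenius_Cauchy actsG) cG; congr (#|pred_of_set _| * _).
  apply: eq_imset => f; apply/setP => g; rewrite -fn_rel_orbit.
  by rewrite in_set in_setT.
rewrite (eq_bigl xpredT) => [|g]; last by rewrite in_setT.
pose Fx (s : {perm 'I_r}) (t : {perm 'I_b}) e := #|equivariant_fns (act_pair s e) (omap t)|.
transitivity (\sum_(g : grp) Fx g.1.1 g.1.2 (odd_perm g.2)).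
  by apply: eq_bigr => -[[s t] e] _; rewrite card_fix.
rewrite -(pair_bigA _ (fun st e => Fx st.1 st.2 (odd_perm e))) /=.
rewrite -(pair_bigA _ (fun s t => \sum_(e : {perm bool}) Fx s t (odd_perm e))) /=.
apply: eq_bigr => s _; apply: eq_bigr => t _; exact: sum_perm_bool.
Qed.

Local Open Scope ring_scope.

(** The zero is counted in [b.+1]. The two halves of [Lf] come from the group elements without and
    with the swap. *)
Lemma num_fn_orbits_Lf : num_fn_orbits%:R = Lf (r + b.+1) b.+1.
Proof.
have pr : (r + b.+1 - b.+1 = r)%N by rewrite addnK.
have pb : (b.+1 - 1 = b)%N by rewrite subn1.
rewrite /Lf /Nf pr pb.
have z2 (x : rat) : x * (r`! * b`! * 2)%N%:R / (r`! * b`! * 2)%N%:R = x.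
  by rewrite mulfK // pnatr_eq0 -lt0n !muln_gt0 !fact_gt0.
rewrite -[LHS]z2 -natrM num_fn_orbitsE.
pose W0 (j : {ffun 'I_b -> 'I_b.+1}) (k : {ffun 'I_r -> 'I_r.+1}) :=
  (\prod_(1 <= a < r.+1) \prod_(1 <= c < r.+1)
     Cc j (lcmn a c) ^ (mult k a * mult k c * gcdn a c))%N.
pose W1 (j : {ffun 'I_b -> 'I_b.+1}) (k : {ffun 'I_r -> 'I_r.+1}) :=
  (\prod_(1 <= a < r.+1)
     (qa j a ^ mult k a * ppow j a a (mult k a ^ 2 - mult k a) *
      \prod_(1 <= c < a) ppow j a c (2 * mult k a * mult k c)))%N.
have E (W : {ffun 'I_b -> 'I_b.+1} -> {ffun 'I_r -> 'I_r.+1} -> nat) :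
  \sum_(s : {perm 'I_r}) \sum_(t : {perm 'I_b}) (W (cycle_type t) (cycle_type s))%:R
  = (r`! * b`!)%:R * \sum_(j in parts b) \sum_(k in parts r)
      ((zc j * zc k)%N%:R)^-1 * (W j k)%:R :> rat.
  rewrite (@sum_cycle_type r _ (fun k => b`!%:R *
    \sum_(j in parts b) (zc j)%:R^-1 * (W j k)%:R)) => [|s]; last first.
    by rewrite (@sum_cycle_type b _ (fun j => (W j (cycle_type s))%:R)).
  rewrite natrM -mulrA; congr (_ * _).
  rewrite [in RHS]exchange_big [RHS]big_distrr /=; apply: eq_bigr => k _.
  rewrite mulrCA; congr (_ * _); rewrite big_distrr /=; apply: eq_bigr => j _.
  by rewrite natrM invfM; ring.
rewrite natr_sum (eq_bigr (fun s => \sum_t (W0 (cycle_type t) (cycle_type s))%:R +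
   \sum_t (W1 (cycle_type t) (cycle_type s))%:R)) => [|s _]; last first.
  rewrite natr_sum -big_split; apply: eq_bigr => t _ /=.
  by rewrite natrD fixed_noswap fixed_swap.
rewrite big_split /= !E.
set A0 := \sum_(j in _) \sum_(k in _) _ * (W0 j k)%:R.
set A1 := \sum_(j in _) \sum_(k in _) _ * (W1 j k)%:R.
rewrite -[RHS]/(2^-1 * A0 + 2^-1 * A1) !natrM; field.
by rewrite !pnatr_eq0 -!lt0n !fact_gt0.
Qed.

End Orbits.

(** * Comparing and splitting numbers of equivalence classes *)

Lemma leq_card_imset_ker (T U V : finType) (f : T -> U) (g : T -> V) (D : {set T}) :
  {in D &, forall x y, f x = f y -> g x = g y} -> #|g @: D| <= #|f @: D|.
Proof.
(* On [D] the map [g] factors through [f] by choosing a preimage; [option V] supplies a value where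
   there is none. *)
move=> fg; pose h c := omap g [pick x in D | f x == c].
have sI : injective (@Some V) by move=> u v [].
rewrite -(card_imset (g @: D) sI).
apply: leq_trans (leq_imset_card h (f @: D)); apply/subset_leq_card/subsetP => o.
move=> /imsetP[_ /imsetP[x xD ->] ->]; apply/imsetP; exists (f x); first exact: imset_f.
rewrite /h; case: pickP => [y /andP[yD /eqP e]|/(_ x)]; last by rewrite /= xD eqxx.
by rewrite /= (fg y x).
Qed.

(** Both partitions are images of [D'], under the class of [phi x] in [D] and the class of [x] in
    [D']; the two maps identify the same points. *)
Lemma card_classes_transfer (T T' : finType) (R : rel T) (R' : rel T')
    (D : {set T}) (D' : {set T'}) (phi : T' -> T) :
  equivalence_rel R -> equivalence_rel R' ->
  {in D', forall x, phi x \in D} ->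
  {in D' &, forall x y, R (phi x) (phi y) = R' x y} ->
  {in D, forall y, exists2 x, x \in D' & R y (phi x)} ->
  #|equivalence_partition R D| = #|equivalence_partition R' D'|.
Proof.
move=> /equivalence_relP[Rr Rt] /equivalence_relP[Rr' Rt'] phiD phiR onto.
pose c x := [set y in D | R (phi x) y]; pose c' x := [set y in D' | R' x y].
have -> : equivalence_partition R D = c @: D'.
  apply/setP => C; apply/imsetP/imsetP => [[y yD ->]|[x xD ->]].
    have [x xD yx] := onto y yD; exists x => //.
    by apply/setP => z; rewrite !inE (Rt _ _ yx).
  by exists (phi x) => //; apply: phiD.
have cP x y : x \in D' -> y \in D' -> c x = c y <-> R' x y.
  move=> xD yD; split=> [/setP/(_ (phi y))|xy].
    by rewrite !inE phiD //= Rr phiR.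
  by apply/setP => z; rewrite !inE (Rt _ (phi y)) // phiR.
have c'P x y : x \in D' -> y \in D' -> c' x = c' y <-> R' x y.
  move=> xD yD; split=> [/setP/(_ y)|xy]; first by rewrite !inE yD /= Rr'.
  by apply/setP => z; rewrite !inE (Rt' _ _ xy).
apply/eqP; rewrite eqn_leq; apply/andP; split.
  by apply: leq_card_imset_ker => x y xD yD /(c'P _ _ xD yD)/(cP _ _ xD yD).
by apply: leq_card_imset_ker => x y xD yD /(cP _ _ xD yD)/(c'P _ _ xD yD).
Qed.

Lemma card_classes_split (T : finType) (R : rel T) (D : {set T}) (h : T -> nat) m n :
  equivalence_rel R -> {in D &, forall x y, R x y -> h x = h y} ->
  {in D, forall x, m <= h x < n} ->
  #|equivalence_partition R D| =
  \sum_(m <= i < n) #|equivalence_partition R [set x in D | h x == i]|.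
Proof.
move=> /equivalence_relP[Rr Rt] hR hb.
(* The common value of [h] on a class; the default 0 concerns only the empty set, which is not a
   class. *)
pose H (C : {set T}) := if [pick x in C] is Some x then h x else 0.
pose cl x := [set y in D | R x y].
have Hcl x : x \in D -> H (cl x) = h x.
  move=> xD; rewrite /H; case: pickP => [y|/(_ x)]; rewrite inE; last by rewrite xD Rr.
  by case/andP=> yD /hR ->.
have cl_i x : x \in D -> cl x = [set y in [set y in D | h y == h x] | R x y].
  move=> xD; apply/setP => y; rewrite !inE; case: (boolP (y \in D)) => //= yD.
  by case: (boolP (R x y)) => [/hR -> //|]; rewrite ?eqxx // andbF.
transitivity (\sum_(m <= i < n) #|[set C in equivalence_partition R D | H C == i]|).
  rewrite -sum1_card.
  rewrite (eq_bigr (fun i => \sum_(C in equivalence_partition R D) (H C == i)));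
    last first => [i _|].
    rewrite -sum1_card big_mkcond [RHS]big_mkcond; apply: eq_bigr => C _.
    by rewrite inE; case: (C \in _) => //=; case: eqP.
  rewrite exchange_big /=; apply: eq_bigr => _ /imsetP[x xD ->].
  have hx := hb x xD; rewrite (bigD1_seq (h x)) ?iota_uniq ?mem_index_iota //=.
  rewrite -/(cl x) Hcl // eqxx big1 // => i /negPf; by rewrite eq_sym => ->.
apply: eq_bigr => i _; congr (#|pred_of_set _|); apply/setP => C; rewrite inE.
apply/andP/imsetP => [[/imsetP[x xD ->] /eqP]|[x]].
  rewrite -/(cl x) Hcl // => <-; exists x; last exact: cl_i.
  by rewrite inE xD eqxx.
rewrite inE => /andP[xD /eqP <-] ->; rewrite -cl_i // Hcl // eqxx; split=> //.
exact: imset_f.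
Qed.

(** * Maps that reach every nonzero value *)

Section Surjective.
Variable r : nat.
Local Notation fn b := {ffun 'I_r * 'I_r -> option 'I_b}.

Definition onto_fn b : {set fn b} :=
  [set f : fn b | [forall y : 'I_b, exists p, f p == Some y]].

Lemma onto_fnP b (f : fn b) :
  reflect (forall y, exists p, f p = Some y) (f \in onto_fn b).
Proof.
rewrite inE; apply: (iffP forallP) => h y; have := h y.
  by case/existsP=> p /eqP; exists p.
by case=> p hp; apply/existsP; exists p; rewrite hp.
Qed.

(** Following [t] by the transposition of [ord_max] and [t ord_max] gives a permutation fixing
    [ord_max]; it differs from [t] only at [ord_max] and at the point that [t] sends there. *)
Lemma perm_restrict_max b (t : {perm 'I_b.+1}) : exists t0 : {perm 'I_b},
  forall y, t (lift ord_max y) != ord_max ->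
            lift ord_max (t0 y) = t (lift ord_max y).
Proof.
pose t' := (t * tperm ord_max (t ord_max))%g.
have t'm y : ord_max != t' (lift ord_max y).
  have e : t' ord_max = ord_max by rewrite permM tpermR.
  by rewrite -{1}e (inj_eq perm_inj) neq_lift.
pose g y := odflt y (unlift ord_max (t' (lift ord_max y))).
have gE y : lift ord_max (g y) = t' (lift ord_max y).
  by rewrite /g; have [z e ->] := unlift_some (t'm y).
have gI : injective g.
  by move=> y z e; apply: (@lift_inj _ ord_max); apply: (@perm_inj _ t'); rewrite -!gE e.
exists (perm gI) => y hy; rewrite permE gE permM tpermD //; first by rewrite eq_sym.
by rewrite (inj_eq perm_inj) neq_lift.
Qed.

Definition widen_fn b (f : fn b) : fn b.+1 := [ffun p => omap (lift ord_max) (f p)].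

(** The permutation of values may move [ord_max], but no value taken by [widen_fn f] is sent there,
    so [perm_restrict_max] applies. *)
Lemma fn_rel_widen b (f g : fn b) : fn_rel (widen_fn f) (widen_fn g) = fn_rel f g.
Proof.
apply/fn_relP/fn_relP => -[s [t [e h]]]; last first.
  exists s, (lift_perm ord_max ord_max t), e => p; rewrite !ffunE h.
  by case: (f p) => //= y; rewrite lift_perm_lift.
have [t0 ht0] := perm_restrict_max t; exists s, t0, e => p.
have := h p; rewrite !ffunE; case: (f p) => [y|]; case: (g _) => [z|] //= [hz].
by congr Some; apply: (@lift_inj _ ord_max); rewrite ht0 // -hz eq_sym neq_lift.
Qed.

Lemma onto_fn_rel b (f g : fn b) : fn_rel f g -> f \in onto_fn b -> g \in onto_fn b.
Proof.
move=> /fn_relP[s [t [e h]]] /onto_fnP fo; apply/onto_fnP => y.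
have [p hp] := fo (t^-1%g y); exists (act_pair s e p).
by rewrite h hp /= permKV.
Qed.

(** A map that is not onto misses some point, which can be moved to [ord_max]; so its class comes
    from a map into one point fewer. *)
Lemma num_onto_classes b :
  num_fn_orbits r b.+1 = #|equivalence_partition (@fn_rel r b.+1) (onto_fn b.+1)|
    + num_fn_orbits r b.
Proof.
rewrite /num_fn_orbits.
rewrite (card_classes_split (h := fun f => f \in onto_fn b.+1 : nat) (m := 0) (n := 2));
  first last.
- by move=> f _; case: (_ \in _).
- move=> f g _ _ fg; congr (nat_of_bool _); apply/idP/idP; first exact: onto_fn_rel.
  apply: onto_fn_rel; move: fg; rewrite !fn_rel_orbit => fg.
  by rewrite orbit_sym.
- exact: fn_rel_equiv.
rewrite !big_nat_recl // big_geq // addn0 addnC; congr (_ + _).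
  congr (#|pred_of_set (equivalence_partition _ _)|).
  by apply/setP => f; rewrite in_set in_setT eqb1.
apply: (card_classes_transfer (phi := @widen_fn b)); try exact: fn_rel_equiv.
- move=> f _; rewrite in_set in_setT eqb0; apply/onto_fnP => /(_ ord_max)[p].
  rewrite ffunE; case: (f p) => //= y [e].
  by have := neq_lift ord_max y; rewrite -val_eqE /= e eqxx.
- by move=> f g _ _; apply: fn_rel_widen.
move=> f; rewrite in_set in_setT eqb0 => /onto_fnP nf.
have [y hy] : exists y, forall p, f p != Some y.
  case: (boolP [exists y, [forall p, f p != Some y]]) => [/existsP[y /forallP hy]|/existsPn h].
    by exists y.
  by case: nf => y; have /forallPn[p /negPn/eqP] := h y; exists p.
(* The missed point [y] is exchanged with [ord_max], which is then deleted from the target. *)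
exists [ffun p => obind (unlift ord_max) (omap (tperm y ord_max) (f p))].
  by rewrite in_setT.
apply/fn_relP; exists 1%g, (tperm y ord_max), false => p.
rewrite act_pair1 !ffunE; have := hy p; case: (f p) => //= z zy.
case: unliftP => [z' -> //|/(canRL (tpermK _ _))].
by rewrite tpermR => e; rewrite e eqxx in zy.
Qed.
End Surjective.

(** * Multiplication tables *)

Section Tables.

Lemma iso_or_antiP n (m1 m2 : table n) :
  reflect (exists (s : {perm 'I_n}) (e : bool), forall x y,
             s (m1 (x, y)) = m2 (swap_if e (s x, s y)))
          (iso_or_anti m1 m2).
Proof.
apply: (iffP orP) => [[]/existsP[s /forallP h]|[s [[] h]]].
- by exists s, false => x y; have /forallP/(_ y)/eqP := h x.
- by exists s, true => x y; have /forallP/(_ y)/eqP := h x.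
- by right; apply/existsP; exists s; apply/forallP => x; apply/forallP => y; rewrite h.
- by left; apply/existsP; exists s; apply/forallP => x; apply/forallP => y; rewrite h.
Qed.

Lemma iso_or_anti_equiv n : equivalence_rel (@iso_or_anti n).
Proof.
have rR : reflexive (@iso_or_anti n).
  by move=> m; apply/iso_or_antiP; exists 1%g, false => x y; rewrite !perm1.
have sR m1 m2 : iso_or_anti m1 m2 -> iso_or_anti m2 m1.
  move=> /iso_or_antiP[s [e h]]; apply/iso_or_antiP; exists s^-1%g, e => x y.
  by apply: (canLR (permK s)); case: e h => h /=; rewrite h /= !permKV.
have tR m1 m2 m3 : iso_or_anti m1 m2 -> iso_or_anti m2 m3 -> iso_or_anti m1 m3.
  move=> /iso_or_antiP[s [e h]] /iso_or_antiP[s' [e' h']].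
  apply/iso_or_antiP; exists (s * s')%g, (e (+) e') => x y.
  by rewrite !permM h; case: e e' {h} h' => -[] h' /=; rewrite h'.
apply/equivalence_relP; split=> // m1 m2 m12 m3.
by apply/idP/idP; apply: tR => //; apply: sR.
Qed.

Lemma card_sq_iso n (m1 m2 : table n) : iso_or_anti m1 m2 -> #|sq m1| = #|sq m2|.
Proof.
move=> /iso_or_antiP[s [e h]]; rewrite -(card_imset (sq m1) (@perm_inj _ s)).
apply: eq_card => x; apply/imsetP/imset2P => [[_ /imset2P[u v _ _ ->] ->]|[u v _ _ ->]].
  by rewrite h; case: e {h} => /=; eexists.
exists (m1 (swap_if e (s^-1%g u, s^-1%g v))).
  by case: e {h} => /=; apply: imset2_f.
by case: e h => h /=; rewrite h /= !permKV.
Qed.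

(* [inl] is A, [inr None] the zero and [inr (Some _)] the other points of S^2. *)
Variables (n r b : nat) (eps : 'I_r + option 'I_b -> 'I_n) (eps' : 'I_n -> 'I_r + option 'I_b).
Hypotheses (epsK : cancel eps eps') (epsK' : cancel eps' eps).
Local Notation U := ('I_r + option 'I_b)%type.
Local Notation fn := {ffun 'I_r * 'I_r -> option 'I_b}.

Definition null_mul (f : fn) (u v : U) : U :=
  match u, v with inl i, inl j => inr (f (i, j)) | _, _ => inr None end.

Definition null_table (f : fn) : table n :=
  [ffun p => eps (null_mul f (eps' p.1) (eps' p.2))].

Lemma null_tableE f u v : null_table f (eps u, eps v) = eps (null_mul f u v).
Proof. by rewrite ffunE /= !epsK. Qed.

Lemma null_mul_inr f u v : exists o, null_mul f u v = inr o.
Proof. by case: u => [i|o]; case: v => [j|o']; eexists. Qed.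

Lemma onto_null_mul f o : f \in onto_fn r b -> exists u v, null_mul f u v = inr o.
Proof.
move=> /onto_fnP fo; case: o => [y|]; last by exists (inr None), (inr None).
by have [[i j] e] := fo y; exists (inl i), (inl j); rewrite /= e.
Qed.

Lemma null_mul3l f u v w : null_mul f (null_mul f u v) w = inr None.
Proof. by have [o ->] := null_mul_inr f u v. Qed.

Lemma null_mul3r f u v w : null_mul f u (null_mul f v w) = inr None.
Proof. by have [o ->] := null_mul_inr f v w; case: u. Qed.

Lemma sq_null_table f : f \in onto_fn r b ->
  sq (null_table f) = [set eps (inr o) | o : option 'I_b].
Proof.
move=> fo; apply/setP => x; apply/imset2P/imsetP => [[x1 x2 _ _ ->]|[o _ ->]].
  rewrite -(epsK' x1) -(epsK' x2) null_tableE.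
  by have [o ->] := null_mul_inr f (eps' x1) (eps' x2); exists o.
have [u [v e]] := onto_null_mul o fo.
by exists (eps u) (eps v); rewrite // null_tableE e.
Qed.

Lemma card_sq_null_table f : f \in onto_fn r b -> #|sq (null_table f)| = b.+1.
Proof.
move=> fo; rewrite sq_null_table // card_imset ?card_option ?card_ord //.
by move=> o o' /(can_inj epsK) [].
Qed.

Lemma nilp3_null_table f : 0 < b -> f \in onto_fn r b -> nilp3 (null_table f).
Proof.
move=> b0 fo; apply/and3P; split.
- apply/forallP => x; apply/forallP => y; apply/forallP => z.
  by rewrite -(epsK' x) -(epsK' y) -(epsK' z) !null_tableE null_mul3l null_mul3r.
- rewrite (_ : cube _ = [set eps (inr None)]) ?cards1 //.
  apply/setP => x; rewrite inE; apply/imset2P/eqP => [[x1 x2]|->].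
    rewrite sq_null_table // => /imsetP[o _ ->] _ ->.
    by rewrite -(epsK' x2) null_tableE.
  exists (eps (inr None)) (eps (inr None)); rewrite ?null_tableE ?in_setT //.
  by rewrite sq_null_table //; apply: imset_f.
- by rewrite card_sq_null_table.
Qed.

Lemma fn_rel_null_iso (f g : fn) :
  fn_rel f g -> iso_or_anti (null_table f) (null_table g).
Proof.
move=> /fn_relP[s [t [e h]]].
pose k (u : U) : U := match u with inl i => inl (s i) | inr o => inr (omap t o) end.
have kI : injective k.
  case=> [i|[y|]] [i'|[y'|]] //= [].
    by move=> /perm_inj ->.
  by move=> /perm_inj ->.
have sI : injective (fun x => eps (k (eps' x))).
  by move=> x y /(can_inj epsK) /kI /(can_inj epsK').
apply/iso_or_antiP; exists (perm sI), e => x y.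
rewrite -(epsK' x) -(epsK' y) null_tableE !permE !epsK.
move: (eps' x) (eps' y) => u v.
have -> : swap_if e (eps (k u), eps (k v)) =
   (eps (if e then k v else k u), eps (if e then k u else k v)) by case: e {h}.
rewrite null_tableE; congr eps.
case: u => [i|o]; case: v => [j|o']; case: e h => h //=.
  by rewrite -h.
by rewrite -h.
Qed.

(** An (anti-)isomorphism preserves the set of products, which is the right summand because [f] is
    onto, and the zero; hence it splits into permutations of the two remaining blocks. *)
Lemma null_iso_fn_rel (f g : fn) : f \in onto_fn r b -> g \in onto_fn r b ->
  iso_or_anti (null_table f) (null_table g) -> fn_rel f g.
Proof.
move=> fo go /iso_or_antiP[s [e hs]].
pose k u := eps' (s (eps u)).
have kI : injective k by move=> u v /(can_inj epsK') /perm_inj /(can_inj epsK).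
have kM u v : k (null_mul f u v) =
    null_mul g (if e then k v else k u) (if e then k u else k v).
  rewrite /k -null_tableE hs; case: e {hs} => /=; rewrite ffunE epsK //.
pose k2 o := if k (inr o) is inr o' then o' else None.
have k2E o : k (inr o) = inr (k2 o).
  have [u [v e1]] := onto_null_mul o fo; rewrite /k2 -e1 kM.
  by have [o' ->] := null_mul_inr g (if e then k v else k u) (if e then k u else k v).
have k2I : injective k2 by move=> o o' e1; apply: inr_inj; apply: kI; rewrite !k2E e1.
have k20 : k2 None = None.
  have := kM (inr None) (inr None); rewrite /= k2E if_same => /=; by case.
pose k1 i := if k (inl i) is inl i' then i' else i.
(* [k2] is injective on a finite set, hence onto: the right summand is already used up. *)
have k1E i : k (inl i) = inl (k1 i).
  rewrite /k1; case e1 : (k (inl i)) => [//|o].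
  by move: e1; rewrite -(f_invF k2I o) -k2E => /kI.
have k1I : injective k1 by move=> i i' e1; apply: inl_inj; apply: kI; rewrite !k1E e1.
pose k3 y := odflt y (k2 (Some y)).
have k3E y : k2 (Some y) = Some (k3 y).
  by rewrite /k3; case e1 : (k2 (Some y)) => [//|]; move: e1; rewrite -k20 => /k2I.
have k3I : injective k3 by move=> y y' e1; apply: Some_inj; apply: k2I; rewrite !k3E e1.
apply/fn_relP; exists (perm k1I), (perm k3I), e => -[i j].
have := kM (inl i) (inl j); rewrite /= !k1E k2E.
have -> : omap (perm k3I) (f (i, j)) = k2 (f (i, j)).
  by case: (f _) => [y|] /=; rewrite ?permE ?k3E ?k20.
by rewrite /act_pair; case: e {hs kM} => /= -[->]; rewrite !permE.
Qed.

(** Naming the points of the complement of [S^2], of [S^2] without the zero, and the zero puts any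
    such table into the form [null_table f]. *)
Lemma nilp3_null_iso (m : table n) : nilp3 m -> #|sq m| = b.+1 ->
  exists2 f, f \in onto_fn r b & iso_or_anti m (null_table f).
Proof.
move=> /and3P[/forallP mA /cards1P[z cz] _] cs.
have mA' x y w : m (m (x, y), w) = m (x, m (y, w)).
  by have /forallP/(_ y)/forallP/(_ w)/eqP := mA x.
have sq_in x y : m (x, y) \in sq m by apply: imset2_f.
have sql u w : u \in sq m -> m (u, w) = z.
  by move=> us; apply/set1P; rewrite -cz; apply: imset2_f.
(* Associativity turns [w(ac)] into [(wa)c], which lies in the cube. *)
have sqr u w : u \in sq m -> m (w, u) = z.
  by case/imset2P=> a c _ _ ->; rewrite -mA' sql.
have zs : z \in sq m.
  have : z \in cube m by rewrite cz set11.
  by case/imset2P=> u w _ _ ->.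
have cU : #|{: U}| = n.
  rewrite -[RHS]card_ord; apply/eqP.
  by rewrite eqn_leq !(leq_card _ (can_inj epsK), leq_card _ (can_inj epsK')).
have cn : r + b.+1 = n by rewrite -cU card_sum card_option !card_ord.
have cA : r = #|~: sq m|.
  by apply: (@addnI b.+1); rewrite -{2}cs cardsC card_ord addnC cn.
have cB : b = #|sq m :\ z|.
  by have := cardsD1 z (sq m); rewrite cs zs => -[].
pose d (u : U) : 'I_n := match u with
  | inl i => enum_val (cast_ord cA i)
  | inr (Some y) => enum_val (cast_ord cB y)
  | inr None => z end.
have dA i : d (inl i) \notin sq m by rewrite -in_setC enum_valP.
have dS o : d (inr o) \in sq m.
  by case: o => // y; have := enum_valP (cast_ord cB y); rewrite inE => /andP[].
have dz y : d (inr (Some y)) != z.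
  by have := enum_valP (cast_ord cB y); rewrite !inE => /andP[].
have dI : injective d.
  case=> [i|o] [i'|o'] e.
  - by move/enum_val_inj/cast_ord_inj: e => ->.
  - by have := dA i; rewrite e dS.
  - by have := dA i'; rewrite -e dS.
  case: o o' e => [y|] [y'|] // e.
  - by move/enum_val_inj/cast_ord_inj: e => ->.
  - by have := dz y; rewrite e eqxx.
  - by have := dz y'; rewrite -e eqxx.
have [d' dK dK'] : bijective d by apply: inj_card_bij; rewrite // cU card_ord.
have sqE x : x \in sq m -> exists o, x = d (inr o).
  by rewrite -(dK' x); case: (d' x) => [i|o _]; [rewrite (negPf (dA i)) | exists o].
(* The default [None] is never taken, since every product lies in [S^2]. *)
pose f : fn := [ffun p => odflt None [pick o | d (inr o) == m (d (inl p.1), d (inl p.2))]].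
have fE u v : m (d u, d v) = d (null_mul f u v).
  case: u => [i|o]; last by rewrite sql.
  case: v => [j|o]; last by rewrite sqr.
  rewrite /= ffunE /=; case: pickP => [o /eqP -> //|].
  by have [o ->] := sqE _ (sq_in (d (inl i)) (d (inl j))) => /(_ o); rewrite eqxx.
exists f.
  apply/onto_fnP => y; have /imset2P[x1 x2 _ _] := dS (Some y).
  rewrite -(dK' x1) -(dK' x2) fE => /dI.
  by case: (d' x1) => [i|?]; case: (d' x2) => [j|?] //= [e]; exists (i, j).
have sI : injective (fun x => eps (d' x)) by move=> x y /(can_inj epsK)/(can_inj dK').
apply/iso_or_antiP; exists (perm sI), false => x y /=.
by rewrite !permE null_tableE -{1}(dK' x) -{1}(dK' y) fE dK.
Qed.

End Tables.

(** * The bound on the size of S^2 *)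

Lemma card_nilp3_level n r b : n = r + b.+1 -> 0 < b ->
  #|equivalence_partition (@iso_or_anti n)
      [set m in [set m : table n | nilp3 m] | #|sq m| == b.+1]|
  = #|equivalence_partition (@fn_rel r b) (onto_fn r b)|.
Proof.
move=> en b0; pose U := ('I_r + option 'I_b)%type.
have cU : #|{: U}| = n by rewrite card_sum card_option !card_ord.
pose eps (u : U) : 'I_n := cast_ord cU (enum_rank u).
pose eps' (x : 'I_n) : U := enum_val (cast_ord (esym cU) x).
have K : cancel eps eps' by move=> u; rewrite /eps /eps' cast_ordK enum_rankK.
have K' : cancel eps' eps by move=> x; rewrite /eps /eps' enum_valK cast_ordKV.
apply: (card_classes_transfer (phi := null_table eps eps')).
- exact: iso_or_anti_equiv.
- exact: fn_rel_equiv.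
- move=> f fo; rewrite !inE (nilp3_null_table K K' b0 fo).
  by rewrite (card_sq_null_table K K' fo) eqxx.
- move=> f g fo go; apply/idP/idP; first exact: null_iso_fn_rel K K' _ _ fo go.
  exact: fn_rel_null_iso K K' _ _.
move=> m; rewrite !inE => /andP[mn /eqP ms].
exact: nilp3_null_iso K K' _ mn ms.
Qed.

Lemma onto_fn_bound r b (f : {ffun 'I_r * 'I_r -> option 'I_b}) :
  f \in onto_fn r b -> b <= r * r.
Proof.
move=> /onto_fnP fo.
have fo' y : exists p, f p == Some y by have [p e] := fo y; exists p; rewrite e.
pose g y := xchoose (fo' y).
have gI : injective g.
  move=> y y' e; have /eqP := xchooseP (fo' y); have /eqP := xchooseP (fo' y').
  by rewrite -/(g y) -/(g y') e => -> [].
by have := leq_card g gI; rewrite card_prod !card_ord.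
Qed.

Section Bound.
Local Open Scope ring_scope.

Lemma an_radicand_ge0 n : (0 < n)%N -> 0 <= n%:R - 3%:R / 4%:R :> algC.
Proof.
move=> n0; rewrite subr_ge0 (le_trans (y := 1)) ?ler1n //.
by rewrite ler_pdivrMr ?mul1r ?ltr0n // ler_nat.
Qed.

Lemma an_real n : (0 < n)%N ->
  n%:R + 2^-1 - sqrtC (n%:R - 3%:R / 4%:R) \is @Num.real algC.
Proof.
move=> n0; have s0 : 0 <= sqrtC (n%:R - 3%:R / 4%:R : algC).
  by rewrite sqrtC_ge0 an_radicand_ge0.
by rewrite rpredB ?rpredD ?ger0_real ?invr_ge0 ?ler0n.
Qed.

(** With [k = n - m] the inequality reads [sqrt(n - 3/4) <= k + 1/2]; squaring gives
    [n <= k^2 + k + 1], that is [m <= k^2 + 1]. *)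
Lemma leq_an n m : (0 < n)%N -> (m <= n)%N ->
  (m%:Z <= an n) = (m <= ((n - m) * (n - m)).+1)%N.
Proof.
move=> n0 mn; set k := (n - m)%N.
have s0 : 0 <= sqrtC (n%:R - 3%:R / 4%:R : algC) by rewrite sqrtC_ge0 an_radicand_ge0.
have h0 : 0 <= 2^-1 :> algC by rewrite invr_ge0 ler0n.
rewrite /an real_floor_ge_int ?an_real //.
have en : n%:R = k%:R + m%:R :> algC by rewrite -natrD subnK.
rewrite lerBrDr -lerBrDl.
have -> : n%:R + 2^-1 - m%:~R = k%:R + 2^-1 :> algC.
  by rewrite en -pmulrn addrAC addrK.
rewrite -(@ler_pXn2r _ 2) ?nnegrE ?addr_ge0 ?ler0n // sqrtCK -subr_ge0.
have -> : (k%:R + 2^-1) ^+ 2 - (n%:R - 3%:R / 4%:R) = (k * k + k + 1)%:R - n%:R :> algC.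
  by rewrite !natrD natrM; field.
rewrite subr_ge0 ler_nat -[X in (X <= _)%N](subnK mn) -/k.
by rewrite addn1 -addSn addnC leq_add2r.
Qed.

Lemma an_bounds n : (0 < n)%N -> (0 < `|an n| <= n)%N /\ an n = `|an n|%:Z.
Proof.
move=> n0; have a1 : 1%:Z <= an n.
  by rewrite leq_an.
have a0 : an n = `|an n|%:Z by rewrite gez0_abs // (le_trans _ a1).
(* The upper bound [an n < n + 1] holds because the root is nonnegative and [1/2 < 1]. *)
split=> //; rewrite -!lez_nat -a0 a1 /= -ltzD1 /an real_floor_lt_int ?an_real //.
rewrite intrD -pmulrn -addrA ltrD2l.
apply: (@le_lt_trans _ _ 2^-1); last by rewrite invf_lt1 ?ltr0n // ltr1n.
by rewrite lerBlDr lerDl sqrtC_ge0 an_radicand_ge0.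
Qed.

End Bound.

(** * Assembling the count by the size of [S^2] *)

Local Open Scope ring_scope.

Theorem theorem2p3 (n : nat) (hn : (1 <= n)%N) :
  (num_nilp3 n)%:R =
    \sum_(2 <= m < `|an n|%N.+1) (Lf n m - Lf (n - 1) (m - 1)) :> rat.
Proof.
have [/andP[a0 an_n] ean] := an_bounds hn.
have nilp3_sq (m : table n) : nilp3 m -> (2 <= #|sq m| < n.+1)%N.
  by case/and3P=> _ _ ->; rewrite ltnS -[X in (_ <= X)%N]card_ord max_card.
rewrite /num_nilp3.
rewrite (card_classes_split (h := fun m => #|sq m|) (m := 2) (n := n.+1)); first last.
- by move=> m; rewrite inE => /nilp3_sq.
- by move=> m1 m2 _ _; apply: card_sq_iso.
- exact: iso_or_anti_equiv.
(* Both sums are taken up to [n], the right one padded with zeros beyond [an n]. *)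
rewrite natr_sum [RHS](big_nat_widen _ _ n.+1) ?ltnS // [RHS]big_mkcond /=.
rewrite [LHS]big_nat_cond [RHS]big_nat_cond; apply: eq_bigr => c /andP[/andP[c2 cn] _].
have {}cn : (c <= n)%N by [].
(* [S^2] has [b + 2] elements, of which [b + 1] are nonzero. *)
have [b eb] : exists b, c = b.+2 by case: c c2 {cn} => [|[|b]] // _; exists b.
have en : n = (n - c + b.+2)%N by rewrite -eb subnK.
rewrite eb (card_nilp3_level en) //.
have Ln : Lf n b.+2 = (num_fn_orbits (n - c) b.+1)%:R by rewrite num_fn_orbits_Lf -en.
have Ln1 : Lf (n - 1) (b.+2 - 1) = (num_fn_orbits (n - c) b)%:R.
  by rewrite num_fn_orbits_Lf subn1 {1}en addnS !subn1.
rewrite Ln Ln1 num_onto_classes natrD addrK -eb ltnS.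
(* Beyond [an n], the complement has too few pairs to reach all [b + 1] nonzero values, so the level
   is empty. *)
case: ifP => // can; rewrite -lez_nat -ean (leq_an hn cn) in can.
rewrite (_ : onto_fn _ _ = set0) ?/equivalence_partition ?imset0 ?cards0 //.
apply/setP => f; rewrite in_set0; apply/negbTE/negP => /onto_fn_bound h.
by move: can; rewrite {1}eb ltnS h.
Qed.
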